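(* Let $(X,\phi)$ be a rational dynamical system over a field $k$. If $(X,\phi)$ admits a covering family of $n$-dimensional invariant subvarieties, then $\operatorname{adim}(X,\phi)\ge \dim X-n$.
   Context: A rational dynamical system $(X,\phi)$ over a field $k$ is an irreducible quasi-projective variety $X$ over $k$ together with a dominant rational map $\phi:X\dashrightarrow X$ over $k$. It induces the $k$-endomorphism $\phi^*:k(X)\to k(X)$, $\phi^*(f)=f\circ\phi$. The algebraic dimension $\operatorname{adim}(X,\phi)$ is the transcendence degree over $k$ of $\operatorname{Fix}(k(X),\phi^* )=\{f\in k(X):\phi^*(f)=f\}$. An invariant subvariety of $(X,\phi)$ is a (closed) subvariety $Z\subseteq X$ over $k$ that is not contained in the indeterminacy locus of $\phi$ and such that $\phi(Z)\subseteq Z$. A family of $n$-dimensional invariant subvarieties of $(X,\phi)$ consists of an irreducible variety $V$ over $k$ and an irreducible subvariety $Z\subseteq V\times X$ such that the co-ordinate projection $Z\to V$ is dominant, $n=\dim Z-\dim V$, and $Z$ is invariant for $(V\times X,\operatorname{id}\times\phi)$. The family is covering if the co-ordinate projection $Z\to X$ is also dominant. (Flatness of $Z\to V$ is not required.) *)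

(* Defs.v *)
From HB Require Import structures.
From mathcomp Require Import all_boot all_order all_algebra.
From mathcomp Require Import boolp classical_sets.
From mathcomp Require Import mpoly.

Set Implicit Arguments.
Unset Strict Implicit.
Unset Printing Implicit Defensive.

Import GRing.Theory.

Local Open Scope classical_set_scope.
Local Open Scope ring_scope.

(* Varieties over an arbitrary field k are taken in the sense of Weil and Serre,
   through their points in an algebraically closed extension iota : k -> K: all
   polynomials have coefficients in k, they are evaluated at points with
   coordinates in K, and the topology is the Zariski topology over k (so that
   irreducible means irreducible over k, not geometrically irreducible).  This
   category is equivalent to that of reduced separated k-schemes of finite
   type, whichever K is chosen. *)

Section TranscendenceDegree.
Variables (k F : fieldType) (c : {rmorphism k -> F}).

Definition alg_independent d (t : 'I_d -> F) : Prop :=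
  forall p : {mpoly k[d]}, mmap c t p = 0 -> p = 0.

Definition has_alg_independent (E : set F) (d : nat) : Prop :=
  exists t : 'I_d -> F, (forall i, E (t i)) /\ alg_independent t.

(* The largest size of an algebraically independent family of elements of the
   subfield E.  The value 0 taken when there is no largest size is never
   reached below: E is always contained in a finitely generated field. *)
Definition trdeg (E : set F) : nat :=
  xget 0%N [set d | has_alg_independent E d /\
                    forall e, has_alg_independent E e -> (e <= d)%N].

End TranscendenceDegree.

Section Varieties.
Variables (k : fieldType) (K : closedFieldType) (iota : {rmorphism k -> K}).

Definition peval n (p : {mpoly k[n]}) (v : 'rV[K]_n) : K := mmap iota (v 0) p.

Definition zeros n (S : set {mpoly k[n]}) : set 'rV[K]_n :=
  [set v | forall p, S p -> peval p v = 0].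

Definition kclosed n (A : set 'rV[K]_n) : Prop :=
  exists S : set {mpoly k[n]}, A = zeros S.

(* A set of points with a finite atlas of affine charts, whose overlaps are open
   in each chart and whose transition maps are locally given by quotients of
   polynomials over k; overlap_closed is separatedness (the diagonal is closed).
   Varieties need be neither irreducible nor quasi-projective. *)
Record variety : Type := Variety {
  pts : Type;
  cidx : finType;
  cdim : cidx -> nat;
  dom : cidx -> set pts;
  chart : forall i, pts -> 'rV[K]_(cdim i);
  chart_cover : forall x, exists i, dom i x;
  chart_inj : forall i x y,
    dom i x -> dom i y -> chart i x = chart i y -> x = y;
  chart_closed : forall i, kclosed (chart i @` dom i);
  overlap_open : forall i j x, dom i x -> dom j x ->
    exists q : {mpoly k[cdim i]}, peval q (chart i x) != 0 /\
      forall y, dom i y -> peval q (chart i y) != 0 -> dom j y;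
  transition_regular : forall i j x (c : 'I_(cdim j)), dom i x -> dom j x ->
    exists p q : {mpoly k[cdim i]}, peval q (chart i x) != 0 /\
      forall y, dom i y -> dom j y -> peval q (chart i y) != 0 ->
        chart j y 0 c = peval p (chart i y) / peval q (chart i y);
  overlap_closed : forall i j,
    kclosed [set row_mx (chart i x) (chart j x) | x in dom i `&` dom j]
}.

(* -------------------------------------------------------------------------- *)

Section Topology.
Variable X : variety.
Implicit Types (U W C : set (pts X)) (f g : pts X -> K).

Definition zclosed C : Prop := forall i : cidx X,
  exists S : set {mpoly k[cdim i]},
    forall x, dom i x -> (C x <-> zeros S (chart i x)).

Definition zopen U : Prop := zclosed (~` U).

Definition dense U : Prop :=
  forall W, zopen W -> W !=set0 -> (U `&` W) !=set0.

Definition irreducible_set C : Prop :=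
  C !=set0 /\
  forall A B, zclosed A -> zclosed B -> C `<=` A `|` B -> C `<=` A \/ C `<=` B.

(* For U open (or open in a closed subset), f is a regular function on U: the
   principal open sets form a basis of the topology of a chart. *)
Definition regular_on U f : Prop :=
  forall (i : cidx X) x, U x -> dom i x ->
    exists p q : {mpoly k[cdim i]}, peval q (chart i x) != 0 /\
      forall y, U y -> dom i y -> peval q (chart i y) != 0 ->
        f y = peval p (chart i y) / peval q (chart i y).

Lemma pevalM n (p q : {mpoly k[n]}) v : peval (p * q) v = peval p v * peval q v.
Proof. exact: rmorphM. Qed.
Lemma pevalD n (p q : {mpoly k[n]}) v : peval (p + q) v = peval p v + peval q v.
Proof. exact: mmapD. Qed.
Lemma pevalN n (p : {mpoly k[n]}) v : peval (- p) v = - peval p v.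
Proof. exact: mmapN. Qed.
Lemma pevalC n c v : peval (c%:MP_[n]) v = iota c.
Proof. exact: mmapC. Qed.
Lemma peval1 n (v : 'rV_n) : peval 1 v = 1.
Proof. by rewrite -mpolyC1 pevalC rmorph1. Qed.

Lemma zopenP U : zopen U <->
  forall i x, U x -> dom i x -> exists p : {mpoly k[cdim i]},
    peval p (chart i x) != 0 /\
    forall y, dom i y -> peval p (chart i y) != 0 -> U y.
Proof.
split=> [oU i x Ux dx|H i].
  have [S HS] := oU i.
  have : ~ zeros S (chart i x) by move=> /(HS x dx); apply.
  move=> /existsNP[p /not_implyP[Sp /eqP px]].
  exists p; split=> // y dy py.
  apply: contrapT => /(HS y dy) /(_ p Sp) py0.
  by rewrite py0 eqxx in py.
exists [set p | forall y, dom i y -> peval p (chart i y) != 0 -> U y].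
move=> x dx; split=> [nUx p Hp|Hx Ux].
  by apply/eqP/negPn/negP => px; apply: nUx; exact: Hp.
by have [p [px Hp]] := H i x Ux dx; rewrite (Hx p Hp) eqxx in px.
Qed.

Lemma zopenT : zopen setT.
Proof.
by apply/zopenP => i x _ dx; exists 1; rewrite peval1 oner_neq0.
Qed.

Lemma zopenI U W : zopen U -> zopen W -> zopen (U `&` W).
Proof.
move=> /zopenP oU /zopenP oW; apply/zopenP => i x [Ux Wx] dx.
have [p [px Hp]] := oU i x Ux dx; have [q [qx Hq]] := oW i x Wx dx.
exists (p * q); split; first by rewrite pevalM mulf_neq0.
move=> y dy; rewrite pevalM mulf_eq0 negb_or => /andP[py qy].
by split; [exact: Hp | exact: Hq].
Qed.

Lemma zopen_local U :
  (forall x, U x -> exists W, [/\ zopen W, W x & W `<=` U]) -> zopen U.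
Proof.
move=> H; apply/zopenP => i x Ux dx.
have [W [/zopenP oW Wx WU]] := H x Ux.
have [p [px Hp]] := oW i x Wx dx.
by exists p; split=> // y dy py; exact/WU/Hp.
Qed.

Lemma zopen_dom (j : cidx X) : zopen (dom j).
Proof. by apply/zopenP => i x dj di; exact: overlap_open. Qed.

Lemma irreducible_setI U W : irreducible_set setT ->
  zopen U -> zopen W -> U !=set0 -> W !=set0 -> (U `&` W) !=set0.
Proof.
move=> [_ irr] oU oW [x Ux] [y Wy]; apply: contrapT => H.
have [|HU|HW] := irr _ _ oU oW.
- move=> z _; apply: contrapT => /not_orP[/contrapT Uz /contrapT Wz].
  by apply: H; exists z.
- exact: HU Ux.
- exact: HW Wy.
Qed.

Lemma regular_sub U W f : W `<=` U -> regular_on U f -> regular_on W f.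
Proof.
move=> WU rf i x Wx dx; have [p [q [qx H]]] := rf i x (WU _ Wx) dx.
by exists p, q; split=> // y /WU Uy; exact: H.
Qed.

Lemma regular_local U f :
  (forall x, U x -> exists W, [/\ zopen W, W x & regular_on W f]) ->
  regular_on U f.
Proof.
move=> H i x Ux dx; have [W [/zopenP oW Wx rf]] := H x Ux.
have [r [rx Hr]] := oW i x Wx dx; have [p [q [qx Hq]]] := rf i x Wx dx.
exists (p * r), (q * r); rewrite pevalM mulf_neq0 //; split=> // y Uy dy.
rewrite pevalM mulf_eq0 negb_or => /andP[qy ry].
rewrite (Hq y) //; last exact: Hr.
by rewrite !pevalM -mulf_div (divff ry) mulr1.
Qed.

Lemma regular_ext U f g : (forall x, U x -> f x = g x) ->
  regular_on U f -> regular_on U g.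
Proof.
move=> fg rf i x Ux dx; have [p [q [qx H]]] := rf i x Ux dx.
by exists p, q; split=> // y Uy dy qy; rewrite -fg // H.
Qed.

Lemma regular_cst U c : regular_on U (fun=> iota c).
Proof.
move=> i x Ux dx; exists c%:MP, 1; rewrite peval1 oner_neq0; split=> // y _ _ _.
by rewrite pevalC peval1 divr1.
Qed.

Lemma regularD U f g : regular_on U f -> regular_on U g ->
  regular_on U (fun x => f x + g x).
Proof.
move=> rf rg i x Ux dx.
have [p [q [qx H]]] := rf i x Ux dx; have [p' [q' [qx' H']]] := rg i x Ux dx.
exists (p * q' + p' * q), (q * q'); rewrite pevalM mulf_neq0 //; split=> // y Uy dy.
rewrite pevalM mulf_eq0 negb_or => /andP[qy qy'].
by rewrite H // H' // pevalD !pevalM addf_div.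
Qed.

Lemma regularN U f : regular_on U f -> regular_on U (fun x => - f x).
Proof.
move=> rf i x Ux dx; have [p [q [qx H]]] := rf i x Ux dx.
by exists (- p), q; split=> // y Uy dy qy; rewrite H // pevalN mulNr.
Qed.

Lemma regularM U f g : regular_on U f -> regular_on U g ->
  regular_on U (fun x => f x * g x).
Proof.
move=> rf rg i x Ux dx.
have [p [q [qx H]]] := rf i x Ux dx; have [p' [q' [qx' H']]] := rg i x Ux dx.
exists (p * p'), (q * q'); rewrite pevalM mulf_neq0 //; split=> // y Uy dy.
rewrite pevalM mulf_eq0 negb_or => /andP[qy qy'].
by rewrite H // H' // !pevalM mulf_div.
Qed.

Lemma regularV U f : zopen U -> regular_on U f ->
  (forall x, U x -> f x != 0) -> regular_on U (fun x => (f x)^-1).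
Proof.
move=> oU rf f0 i x Ux dx; have [p [q [qx H]]] := rf i x Ux dx.
exists (q * q), (q * p); split=> [|y Uy dy].
  rewrite pevalM mulf_neq0 //.
  by apply: contraNneq (f0 _ Ux) => px; rewrite H // px mul0r.
rewrite !pevalM mulf_eq0 negb_or => /andP[qy py].
by rewrite H // invf_div -mulf_div (divff qy) mul1r.
Qed.

Lemma zopen_neq0 U f : zopen U -> regular_on U f ->
  zopen (U `&` [set x | f x != 0]).
Proof.
move=> /zopenP oU rf; apply/zopenP => i x [Ux fx] dx.
have [r [rx Hr]] := oU i x Ux dx; have [p [q [qx H]]] := rf i x Ux dx.
exists (r * (p * q)); rewrite !pevalM; split.
  rewrite !mulf_neq0 //.
  by apply: contraNneq fx => px; rewrite H // px mul0r.
move=> y dy; rewrite !pevalM !mulf_eq0 !negb_or => /and3P[ry py qy].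
have Uy := Hr y dy ry.
by split=> //=; rewrite H // mulf_neq0 // invr_eq0.
Qed.

Lemma regular_prod U (I : Type) (s : seq I) (F : I -> pts X -> K) :
  (forall i, regular_on U (F i)) -> regular_on U (fun x => \prod_(i <- s) F i x).
Proof.
move=> rF; elim: s => [|i s IH].
  apply: (@regular_ext _ (fun=> iota 1)); last exact: regular_cst.
  by move=> x _; rewrite big_nil rmorph1.
apply: (@regular_ext _ (fun x => F i x * \prod_(i <- s) F i x)).
  by move=> x _; rewrite big_cons.
exact: regularM.
Qed.

Lemma regularX U f n : regular_on U f -> regular_on U (fun x => f x ^+ n).
Proof.
move=> rf; elim: n => [|n IH].
  apply: (@regular_ext _ (fun=> iota 1)); last exact: regular_cst.
  by move=> x _; rewrite rmorph1 expr0.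
apply: (@regular_ext _ (fun x => f x * f x ^+ n)).
  by move=> x _; rewrite exprS.
exact: regularM.
Qed.

Lemma regular_peval U n (g : 'I_n -> pts X -> K) (p : {mpoly k[n]}) :
  (forall c, regular_on U (g c)) ->
  regular_on U (fun x => peval p (\row_c g c x)).
Proof.
move=> rg; elim/mpolyind: p => [|c m p _ _ IH].
  apply: (@regular_ext _ (fun=> iota 0)); last exact: regular_cst.
  by move=> x _; rewrite -mpolyC0 pevalC.
pose h x := iota c * mmap1 (fun i => g i x) m.
apply: (@regular_ext _ (fun x => h x + peval p (\row_c g c x))).
  move=> x _; rewrite pevalD; congr (_ + _).
  rewrite /peval mmapZ mmapX; congr (_ * _); apply: mmap1_eq => i.
  by rewrite mxE.
apply: regularD => //; apply: regularM; first exact: regular_cst.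
by apply: regular_prod => i; exact: regularX.
Qed.

End Topology.

(* -------------------------------------------------------------------------- *)

Section Products.

Lemma peval_comp n m (h : 'I_n -> {mpoly k[m]}) (p : {mpoly k[n]}) v :
  peval (mmap (mpolyC m (R:=k)) h p) v = peval p (\row_c peval (h c) v).
Proof.
elim/mpolyind: p => [|c m' p _ _ IH].
  by rewrite mmap0 -!mpolyC0 !pevalC.
rewrite mmapD !pevalD IH; congr (_ + _).
rewrite mmapZ mmapX pevalM pevalC /peval mmapZ mmapX; congr (_ * _).
rewrite /mmap1 rmorph_prod; apply: eq_bigr => i _.
by rewrite rmorphXn mxE.
Qed.

Definition plift n m (s : 'I_n -> 'I_m) (p : {mpoly k[n]}) : {mpoly k[m]} :=
  mmap (mpolyC m (R:=k)) (fun c => 'X_(s c)) p.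

Lemma peval_plift n m (s : 'I_n -> 'I_m) p v :
  peval (plift s p) v = peval p (\row_c v 0 (s c)).
Proof.
rewrite peval_comp; congr peval; apply/rowP => c.
by rewrite !mxE /peval mmapX mmap1U.
Qed.

Lemma kclosed_preim n m (s : 'I_n -> 'I_m) (A : set 'rV[K]_n) :
  kclosed A -> kclosed [set v : 'rV[K]_m | A (\row_c v 0 (s c))].
Proof.
move=> [S ->]; exists [set plift s p | p in S].
apply/seteqP; split=> v /= H p.
  by move=> [q Sq <-]; rewrite peval_plift; exact: H.
by move=> Sp; rewrite -peval_plift; apply: H; exists p.
Qed.

Lemma kclosedI n (A B : set 'rV[K]_n) :
  kclosed A -> kclosed B -> kclosed (A `&` B).
Proof.
move=> [S ->] [T ->]; exists (S `|` T); apply/seteqP; split=> v /=.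
  by move=> [HS HT] p [/HS|/HT].
by move=> H; split=> p Hp; apply: H; [left | right].
Qed.

Lemma plift_lshift n m p (a : 'rV[K]_n) (b : 'rV[K]_m) :
  peval (plift (lshift m) p) (row_mx a b) = peval p a.
Proof.
rewrite peval_plift; congr peval; apply/rowP => c.
by rewrite !mxE (unsplitK (inl c)).
Qed.

Lemma plift_rshift n m p (a : 'rV[K]_n) (b : 'rV[K]_m) :
  peval (plift (@rshift n m) p) (row_mx a b) = peval p b.
Proof.
rewrite peval_plift; congr peval; apply/rowP => c.
by rewrite !mxE (unsplitK (inr c)).
Qed.

Lemma row_mx_l n m (a : 'rV[K]_n) (b : 'rV[K]_m) :
  \row_c (row_mx a b) 0 (lshift m c) = a.
Proof. by apply/rowP => c; rewrite !mxE (unsplitK (inl c)). Qed.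

Lemma row_mx_r n m (a : 'rV[K]_n) (b : 'rV[K]_m) :
  \row_c (row_mx a b) 0 (@rshift n m c) = b.
Proof. by apply/rowP => c; rewrite !mxE (unsplitK (inr c)). Qed.

Variables X Y : variety.

Definition prod_dom (ij : cidx X * cidx Y) : set (pts X * pts Y) :=
  [set z | dom ij.1 z.1 /\ dom ij.2 z.2].

Definition prod_chart (ij : cidx X * cidx Y) (z : pts X * pts Y) :
    'rV[K]_(cdim ij.1 + cdim ij.2) :=
  row_mx (chart ij.1 z.1) (chart ij.2 z.2).

Lemma prod_chart_cover z : exists ij, prod_dom ij z.
Proof.
have [i di] := chart_cover z.1; have [j dj] := chart_cover z.2.
by exists (i, j).
Qed.

Lemma prod_chart_inj ij z w :
  prod_dom ij z -> prod_dom ij w -> prod_chart ij z = prod_chart ij w -> z = w.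
Proof.
case: z w => [x y] [x' y'] [/= dx dy] [/= dx' dy'] /eq_row_mx[/= e1 e2].
by rewrite (chart_inj dx dx' e1) (chart_inj dy dy' e2).
Qed.

Lemma prod_chart_closed ij : kclosed (prod_chart ij @` prod_dom ij).
Proof.
case: ij => i j.
have := kclosedI
  (kclosed_preim (lshift (cdim j)) (chart_closed i))
  (kclosed_preim (@rshift (cdim i) (cdim j)) (chart_closed j)).
congr kclosed; apply/seteqP; split=> v /=.
  move=> [[x dx ex] [y dy ey]]; exists (x, y) => //.
  rewrite /prod_chart /= ex ey; apply/rowP => c; rewrite mxE.
  by case: splitP => d dc; rewrite mxE; congr (v 0 _); apply/val_inj.
move=> [[x y] [/= dx dy] <-]; rewrite /prod_chart /= row_mx_l row_mx_r.
by split; [exists x | exists y].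
Qed.

Lemma prod_overlap_open ij i'j' z : prod_dom ij z -> prod_dom i'j' z ->
  exists q : {mpoly k[cdim ij.1 + cdim ij.2]},
    peval q (prod_chart ij z) != 0 /\
    forall w, prod_dom ij w -> peval q (prod_chart ij w) != 0 ->
      prod_dom i'j' w.
Proof.
move=> [dx dy] [dx' dy'].
have [p [px Hp]] := overlap_open dx dx'.
have [q [qy Hq]] := overlap_open dy dy'.
exists (plift (lshift _) p * plift (@rshift _ _) q).
rewrite /prod_chart pevalM plift_lshift plift_rshift mulf_neq0 //; split=> //.
move=> w [wx wy]; rewrite pevalM plift_lshift plift_rshift mulf_eq0 negb_or.
by move=> /andP[pw qw]; split; [exact: Hp | exact: Hq].
Qed.

Lemma prod_transition ij i'j' z (c : 'I_(cdim i'j'.1 + cdim i'j'.2)) :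
  prod_dom ij z -> prod_dom i'j' z ->
  exists p q : {mpoly k[cdim ij.1 + cdim ij.2]},
    peval q (prod_chart ij z) != 0 /\
    forall w, prod_dom ij w -> prod_dom i'j' w ->
      peval q (prod_chart ij w) != 0 ->
      prod_chart i'j' w 0 c
        = peval p (prod_chart ij w) / peval q (prod_chart ij w).
Proof.
move=> [dx dy] [dx' dy']; rewrite /prod_chart.
case: (splitP c) => d dc.
  have -> : c = lshift _ d by exact/val_inj.
  have [p [q [qx H]]] := transition_regular d dx dx'.
  exists (plift (lshift _) p), (plift (lshift _) q).
  rewrite plift_lshift; split=> // w [wx wy] [wx' wy'].
  by rewrite !plift_lshift row_mxEl; exact: H.
have -> : c = rshift _ d by exact/val_inj.
have [p [q [qx H]]] := transition_regular d dy dy'.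
exists (plift (@rshift _ _) p), (plift (@rshift _ _) q).
rewrite plift_rshift; split=> // w [wx wy] [wx' wy'].
by rewrite !plift_rshift row_mxEr; exact: H.
Qed.

Lemma prod_overlap_closed ij i'j' :
  kclosed [set row_mx (prod_chart ij z) (prod_chart i'j' z)
          | z in prod_dom ij `&` prod_dom i'j'].
Proof.
case: ij i'j' => [i j] [i' j'].
pose s1 (c : 'I_(cdim i + cdim i')) :
    'I_((cdim i + cdim j) + (cdim i' + cdim j')) :=
  match split c with
  | inl d => lshift _ (lshift _ d) | inr d => rshift _ (lshift _ d) end.
pose s2 (c : 'I_(cdim j + cdim j')) :
    'I_((cdim i + cdim j) + (cdim i' + cdim j')) :=
  match split c with
  | inl d => lshift _ (rshift _ d) | inr d => rshift _ (rshift _ d) end.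
have e1 a b a' b' : \row_c (row_mx (row_mx a b) (row_mx a' b')) 0 (s1 c)
    = row_mx a a' :> 'rV[K]_(_ + _).
  apply/rowP => c; rewrite mxE /s1 [RHS]mxE.
  by case: (split c) => d; rewrite ?row_mxEl ?row_mxEr ?row_mxEl.
have e2 a b a' b' : \row_c (row_mx (row_mx a b) (row_mx a' b')) 0 (s2 c)
    = row_mx b b' :> 'rV[K]_(_ + _).
  apply/rowP => c; rewrite mxE /s2 [RHS]mxE.
  by case: (split c) => d; rewrite ?row_mxEl ?row_mxEr ?row_mxEr.
have := kclosedI (kclosed_preim s1 (overlap_closed i i'))
                 (kclosed_preim s2 (overlap_closed j j')).
congr kclosed; apply/seteqP; split=> v /=; last first.
  move=> [[x y] [/= [/= dx dy] [/= dx' dy']] <-].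
  rewrite /prod_chart /= e1 e2.
  by split; [exists x | exists y].
rewrite -[v]hsubmxK -[lsubmx v]hsubmxK -[rsubmx v]hsubmxK e1 e2.
move=> [[x [dx dx'] /eq_row_mx[<- <-]] [y [dy dy'] /eq_row_mx[<- <-]]].
by exists (x, y).
Qed.

Definition prod_variety : variety :=
  Variety prod_chart_cover prod_chart_inj prod_chart_closed
    prod_overlap_open prod_transition prod_overlap_closed.

End Products.

(* -------------------------------------------------------------------------- *)

Section ClosedSubvariety.
Variables (X : variety) (Z : set (pts X)) (Zcl : zclosed Z).

Definition sub_dom (i : cidx X) : set {x : pts X | Z x} :=
  [set x | dom i (sval x)].

Definition sub_chart (i : cidx X) (x : {x : pts X | Z x}) : 'rV[K]_(cdim i) :=
  chart i (sval x).

Lemma sub_chart_cover x : exists i, sub_dom i x.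
Proof. exact: chart_cover. Qed.

Lemma sub_chart_inj i x y :
  sub_dom i x -> sub_dom i y -> sub_chart i x = sub_chart i y -> x = y.
Proof.
case: x y => [x Zx] [y Zy] /= dx dy e; have xy : x = y by exact: chart_inj e.
by subst y; rewrite (Prop_irrelevance Zx Zy).
Qed.

Lemma sub_chart_closed i : kclosed (sub_chart i @` sub_dom i).
Proof.
have [S HS] := Zcl i.
have kS : kclosed (zeros S) by exists S.
have := kclosedI (chart_closed i) kS.
congr kclosed; apply/seteqP; split=> v /=.
  move=> [[x dx <-] /(HS x dx) Zx].
  by exists (exist _ x Zx).
move=> [[x Zx] dx <-]; split; first by exists x.
by apply/HS.
Qed.

Lemma sub_overlap_open i j x : sub_dom i x -> sub_dom j x ->
  exists q : {mpoly k[cdim i]}, peval q (sub_chart i x) != 0 /\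
    forall y, sub_dom i y -> peval q (sub_chart i y) != 0 -> sub_dom j y.
Proof.
move=> di dj; have [q [qx H]] := overlap_open di dj.
by exists q; split=> // y; exact: H.
Qed.

Lemma sub_transition i j x (c : 'I_(cdim j)) : sub_dom i x -> sub_dom j x ->
  exists p q : {mpoly k[cdim i]}, peval q (sub_chart i x) != 0 /\
    forall y, sub_dom i y -> sub_dom j y -> peval q (sub_chart i y) != 0 ->
      sub_chart j y 0 c = peval p (sub_chart i y) / peval q (sub_chart i y).
Proof.
move=> di dj; have [p [q [qx H]]] := transition_regular c di dj.
by exists p, q; split=> // y; exact: H.
Qed.

Lemma sub_overlap_closed i j :
  kclosed [set row_mx (sub_chart i x) (sub_chart j x)
          | x in sub_dom i `&` sub_dom j].
Proof.
have [S HS] := Zcl i.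
have kS : kclosed (zeros S) by exists S.
have := kclosedI (overlap_closed i j) (kclosed_preim (lshift (cdim j)) kS).
congr kclosed; apply/seteqP; split=> v /=.
  move=> [[x [di dj] <-]]; rewrite row_mx_l => /(HS x di) Zx.
  by exists (exist _ x Zx).
move=> [[x Zx] [di dj] <-]; rewrite row_mx_l; split; first by exists x.
by apply/HS.
Qed.

Definition closed_subvariety : variety :=
  Variety sub_chart_cover sub_chart_inj sub_chart_closed
    sub_overlap_open sub_transition sub_overlap_closed.

End ClosedSubvariety.

(* -------------------------------------------------------------------------- *)

Definition homogeneous n (S : set {mpoly k[n]}) : Prop :=
  forall p, S p -> exists d, p \is d.-homog.

(* e x is a vector of homogeneous coordinates of a point of the projective
   space; the conditions say that e induces an isomorphism from X onto a
   locally closed subset of it, that is, a homeomorphism which identifies the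
   regular functions with the local quotients of forms of the same degree. *)
Definition quasi_projective (X : variety) : Prop :=
  exists (N : nat) (e : pts X -> 'rV[K]_N.+1),
  [/\ (forall x, e x != 0) /\ (forall x y c, e x = c *: e y -> x = y),
      exists F G : set {mpoly k[N.+1]},
        [/\ homogeneous F, homogeneous G &
            forall v : 'rV[K]_N.+1, v != 0 ->
              (exists x c, v = c *: e x) <-> zeros F v /\ ~ zeros G v],
      forall C : set (pts X), zclosed C <->
        exists2 S : set {mpoly k[N.+1]}, homogeneous S &
          C = [set x | zeros S (e x)]
    & forall (U : set (pts X)) (f : pts X -> K), zopen U ->
        regular_on U f <->
        forall x, U x -> exists (d : nat) (p q : {mpoly k[N.+1]}),
          [/\ p \is d.-homog, q \is d.-homog, peval q (e x) != 0 &
              forall y, U y -> peval q (e y) != 0 ->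
                f y = peval p (e y) / peval q (e y)]].

(* -------------------------------------------------------------------------- *)

Record irr_variety : Type := IrrVariety {
  irr_val :> variety;
  irr_irr : irreducible_set [set: pts irr_val]
}.

Record irr_subvariety (X : variety) : Type := IrrSubvariety {
  isv_set : set (pts X);
  isv_closed : zclosed isv_set;
  isv_irr : irreducible_set isv_set
}.

Lemma closed_subvariety_irr (X : variety) (Z : irr_subvariety X) :
  irreducible_set [set: pts (closed_subvariety (isv_closed Z))].
Proof.
case: Z => Z Zcl [[x Zx] irr] /=; split; first by exists (exist _ x Zx).
have ext (A : set (pts (closed_subvariety Zcl))) : zclosed A ->
    zclosed [set y | exists Zy : Z y, A (exist _ y Zy)].
  move=> Acl i; have [S HS] := Zcl i; have [T HT] := Acl i.
  exists (S `|` T) => y dy; split.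
    move=> [Zy Ay] p [Sp|Tp]; first exact: (HS y dy).1 Zy p Sp.
    exact: (HT (exist _ y Zy) dy).1 Ay p Tp.
  move=> Hy; have Zy : Z y by apply: (HS y dy).2 => p Sp; apply: Hy; left.
  by exists Zy; apply: (HT (exist _ y Zy) dy).2 => p Tp; apply: Hy; right.
move=> A B /ext Acl /ext Bcl HAB; have [|HA|HB] := irr _ _ Acl Bcl.
- by move=> y Zy; have [//|HA|HB] := HAB (exist _ y Zy); [left | right]; exists Zy.
- by left=> -[y Zy] _; have [Zy' ?] := HA y Zy; rewrite (Prop_irrelevance Zy Zy').
- by right=> -[y Zy] _; have [Zy' ?] := HB y Zy; rewrite (Prop_irrelevance Zy Zy').
Qed.

Definition irr_variety_of (X : variety) (Z : irr_subvariety X) : irr_variety :=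
  IrrVariety (closed_subvariety_irr Z).

(* -------------------------------------------------------------------------- *)

Section FunctionField.
Variable X : irr_variety.

Record ratrep : Type := Ratrep {
  rdom : set (pts X);
  rval : pts X -> K;
  rdom_open : zopen rdom;
  rdom_neq0 : rdom !=set0;
  rval_regular : regular_on rdom rval
}.

HB.instance Definition _ := gen_eqMixin ratrep.
HB.instance Definition _ := gen_choiceMixin ratrep.

Definition rateq (f g : ratrep) : Prop :=
  exists W : set (pts X),
    [/\ zopen W, W !=set0, W `<=` rdom f `&` rdom g &
        forall x, W x -> rval f x = rval g x].

Definition rateqb : rel ratrep := fun f g => `[< rateq f g >].

Lemma rateqb_equiv : equiv_class_of rateqb.
Proof.
split=> [f|f g|g f h].
- apply/asboolP; exists (rdom f).
  by split=> //; [exact: rdom_open | exact: rdom_neq0].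
- by apply/asboolP/asboolP => -[W [oW nW sW eW]]; exists W; split=> // x Wx;
    [have [] := sW x Wx | rewrite eW | have [] := sW x Wx | rewrite eW].
- move=> /asboolP[W [oW nW sW eW]] /asboolP[W' [oW' nW' sW' eW']].
  apply/asboolP; exists (W `&` W'); split.
  + exact: zopenI.
  + by apply: irreducible_setI => //; exact: irr_irr.
  + by move=> x [/sW[? _] /sW'[_ ?]].
  + by move=> x [Wx W'x]; rewrite eW // eW'.
Qed.

Canonical rateqb_equivRel := EquivRelPack rateqb_equiv.

Definition ratfun : Type := {eq_quot rateqb}%qT.

HB.instance Definition _ := Choice.on ratfun.
HB.instance Definition _ := EqQuotient.on ratfun.

Definition rpi (f : ratrep) : ratfun := (\pi_ratfun f)%qT.

Lemma rpiP f g : rpi f = rpi g <-> rateq f g.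
Proof.
split=> [/eqmodP/asboolP //|H]; exact/eqmodP/asboolP.
Qed.

Lemma rpi_repr (x : ratfun) : rpi (repr x) = x.
Proof. exact: reprK. Qed.

Lemma rateq_repr f : rateq (repr (rpi f)) f.
Proof. by apply/rpiP; rewrite rpi_repr. Qed.

Definition rep_const (c : k) : ratrep :=
  @Ratrep setT (fun=> iota c) (@zopenT X) (irr_irr X).1 (@regular_cst X setT c).

Lemma rdomI_open f g : zopen (rdom f `&` rdom g).
Proof. by apply: zopenI; exact: rdom_open. Qed.

Lemma rdomI_neq0 f g : (rdom f `&` rdom g) !=set0.
Proof.
apply: irreducible_setI (irr_irr X) _ _ _ _;
  by [exact: rdom_open | exact: rdom_neq0].
Qed.

Lemma rep_add_regular f g :
  regular_on (rdom f `&` rdom g) (fun x => rval f x + rval g x).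
Proof.
by apply: regularD; [apply: regular_sub (@rval_regular f) | apply: regular_sub (@rval_regular g)] => x [].
Qed.

Lemma rep_mul_regular f g :
  regular_on (rdom f `&` rdom g) (fun x => rval f x * rval g x).
Proof.
by apply: regularM; [apply: regular_sub (@rval_regular f) | apply: regular_sub (@rval_regular g)] => x [].
Qed.

Definition rep_add f g : ratrep :=
  Ratrep (rdomI_open f g) (rdomI_neq0 f g) (@rep_add_regular f g).

Definition rep_mul f g : ratrep :=
  Ratrep (rdomI_open f g) (rdomI_neq0 f g) (@rep_mul_regular f g).

Definition rep_opp f : ratrep :=
  Ratrep (rdom_open f) (rdom_neq0 f) (regularN (@rval_regular f)).

Lemma rep_inv_regular f :
  regular_on (rdom f `&` [set x | rval f x != 0]) (fun x => (rval f x)^-1).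
Proof.
apply: regularV => [||x []//].
  by apply: zopen_neq0 (rdom_open f) (@rval_regular f).
by apply: regular_sub (@rval_regular f) => x [].
Qed.

Definition rep_inv f : ratrep :=
  match pselect ((rdom f `&` [set x | rval f x != 0]) !=set0) with
  | left nz => Ratrep (zopen_neq0 (rdom_open f) (@rval_regular f)) nz
                 (@rep_inv_regular f)
  | right _ => rep_const 0
  end.

Definition ratfun_const (c : k) : ratfun := rpi (rep_const c).
Definition ratfun_add (x y : ratfun) : ratfun := rpi (rep_add (repr x) (repr y)).
Definition ratfun_mul (x y : ratfun) : ratfun := rpi (rep_mul (repr x) (repr y)).
Definition ratfun_opp (x : ratfun) : ratfun := rpi (rep_opp (repr x)).
Definition ratfun_inv (x : ratfun) : ratfun := rpi (rep_inv (repr x)).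

Lemma rpi_val f g :
  (forall x, rdom f x -> rdom g x -> rval f x = rval g x) -> rpi f = rpi g.
Proof.
move=> H; apply/rpiP; exists (rdom f `&` rdom g); split=> //.
- exact: rdomI_open.
- exact: rdomI_neq0.
- by move=> x [fx gx]; exact: H.
Qed.

Lemma rpi_add f g : ratfun_add (rpi f) (rpi g) = rpi (rep_add f g).
Proof.
have [W [oW nW sW eW]] := rateq_repr f.
have [W' [oW' nW' sW' eW']] := rateq_repr g.
apply/rpiP; exists (W `&` W'); split.
- exact: zopenI.
- by apply: irreducible_setI => //; exact: irr_irr.
- by move=> x [/sW[? ?] /sW'[? ?]].
- by move=> x [Wx W'x] /=; rewrite eW // eW'.
Qed.

Lemma rpi_mul f g : ratfun_mul (rpi f) (rpi g) = rpi (rep_mul f g).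
Proof.
have [W [oW nW sW eW]] := rateq_repr f.
have [W' [oW' nW' sW' eW']] := rateq_repr g.
apply/rpiP; exists (W `&` W'); split.
- exact: zopenI.
- by apply: irreducible_setI => //; exact: irr_irr.
- by move=> x [/sW[? ?] /sW'[? ?]].
- by move=> x [Wx W'x] /=; rewrite eW // eW'.
Qed.

Lemma rpi_opp f : ratfun_opp (rpi f) = rpi (rep_opp f).
Proof.
have [W [oW nW sW eW]] := rateq_repr f.
by apply/rpiP; exists W; split=> // x Wx /=; rewrite eW.
Qed.

Lemma ratfunW (P : ratfun -> Prop) : (forall f, P (rpi f)) -> forall x, P x.
Proof. by move=> H x; rewrite -(rpi_repr x). Qed.

Lemma ratfun_addA : associative ratfun_add.
Proof.
elim/ratfunW=> f; elim/ratfunW=> g; elim/ratfunW=> h; rewrite !rpi_add.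
by apply: rpi_val => x _ _ /=; rewrite addrA.
Qed.

Lemma ratfun_addC : commutative ratfun_add.
Proof.
elim/ratfunW=> f; elim/ratfunW=> g; rewrite !rpi_add.
by apply: rpi_val => x _ _ /=; rewrite addrC.
Qed.

Lemma ratfun_add0 : left_id (ratfun_const 0) ratfun_add.
Proof.
elim/ratfunW=> f; rewrite rpi_add.
by apply: rpi_val => x _ _ /=; rewrite rmorph0 add0r.
Qed.

Lemma ratfun_addN : left_inverse (ratfun_const 0) ratfun_opp ratfun_add.
Proof.
elim/ratfunW=> f; rewrite rpi_opp rpi_add.
by apply: rpi_val => x _ _ /=; rewrite rmorph0 addNr.
Qed.

Lemma ratfun_mulA : associative ratfun_mul.
Proof.
elim/ratfunW=> f; elim/ratfunW=> g; elim/ratfunW=> h; rewrite !rpi_mul.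
by apply: rpi_val => x _ _ /=; rewrite mulrA.
Qed.

Lemma ratfun_mulC : commutative ratfun_mul.
Proof.
elim/ratfunW=> f; elim/ratfunW=> g; rewrite !rpi_mul.
by apply: rpi_val => x _ _ /=; rewrite mulrC.
Qed.

Lemma ratfun_mul1 : left_id (ratfun_const 1) ratfun_mul.
Proof.
elim/ratfunW=> f; rewrite rpi_mul.
by apply: rpi_val => x _ _ /=; rewrite rmorph1 mul1r.
Qed.

Lemma ratfun_mulDl : left_distributive ratfun_mul ratfun_add.
Proof.
elim/ratfunW=> f; elim/ratfunW=> g; elim/ratfunW=> h.
rewrite !(rpi_mul, rpi_add).
by apply: rpi_val => x _ _ /=; rewrite mulrDl.
Qed.

Lemma ratfun_1_neq0 : ratfun_const 1 != ratfun_const 0.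
Proof.
apply/eqP => /rpiP[W [_ [x Wx] _ /(_ x Wx)]] /=.
by rewrite rmorph1 rmorph0 => /eqP; rewrite oner_eq0.
Qed.

HB.instance Definition _ := GRing.isZmodule.Build ratfun
  ratfun_addA ratfun_addC ratfun_add0 ratfun_addN.

HB.instance Definition _ := GRing.Zmodule_isComNzRing.Build ratfun
  ratfun_mulA ratfun_mulC ratfun_mul1 ratfun_mulDl ratfun_1_neq0.

Lemma ratfun_mulV (x : ratfun) : x != 0 -> ratfun_inv x * x = 1.
Proof.
move=> x0; rewrite -[X in _ * X]rpi_repr -[LHS]/(ratfun_mul _ _) rpi_mul.
rewrite /rep_inv; case: pselect => [nz|nz].
  by apply: rpi_val => y [[_ /= fy] _] _ /=; rewrite mulVf // rmorph1.
case/eqP: x0; rewrite -(rpi_repr x); apply: rpi_val => y fy _ /=.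
by rewrite rmorph0; apply: contrapT => /eqP fy0; apply: nz; exists y.
Qed.

Lemma ratfun_inv0 : ratfun_inv 0 = 0.
Proof.
rewrite /ratfun_inv /rep_inv; case: pselect => // nz; exfalso.
have [W [oW nW sW eW]] := rateq_repr (rep_const 0).
have [x [Wx [_ /= /eqP]]] :=
  irreducible_setI (irr_irr X) oW
    (zopen_neq0 (rdom_open (repr (0 : ratfun))) (@rval_regular _)) nW nz.
by rewrite eW //= rmorph0.
Qed.

HB.instance Definition _ :=
  GRing.ComNzRing_isField.Build ratfun ratfun_mulV ratfun_inv0.

Lemma ratfun_const_is_zmod : zmod_morphism ratfun_const.
Proof.
move=> a b; rewrite -[RHS]/(ratfun_add _ (ratfun_opp _)) rpi_opp rpi_add.
by apply: rpi_val => x _ _ /=; rewrite rmorphB.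
Qed.

Lemma ratfun_const_is_monoid : monoid_morphism ratfun_const.
Proof.
split=> // a b; rewrite -[RHS]/(ratfun_mul _ _) rpi_mul.
by apply: rpi_val => x _ _ /=; rewrite rmorphM.
Qed.

HB.instance Definition _ := GRing.isZmodMorphism.Build k ratfun ratfun_const
  ratfun_const_is_zmod.
HB.instance Definition _ := GRing.isMonoidMorphism.Build k ratfun ratfun_const
  ratfun_const_is_monoid.

End FunctionField.

Definition variety_dim (X : irr_variety) : nat := trdeg (@ratfun_const X) setT.

(* -------------------------------------------------------------------------- *)

Section PartialMorphisms.
Variables X Y : variety.

Definition morphism_on (U : set (pts X)) (f : pts X -> pts Y) : Prop :=
  forall x, U x -> forall j : cidx Y, dom j (f x) ->
    exists W : set (pts X), [/\ zopen W, W x, W `<=` U,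
      forall y, W y -> dom j (f y) &
      forall c, regular_on W (fun y => chart j (f y) 0 c)].

(* The values of pm_fun outside of pm_dom are irrelevant. *)
Record partial_morphism : Type := PartialMorphism {
  pm_dom : set (pts X);
  pm_fun : pts X -> pts Y;
  pm_open : zopen pm_dom;
  pm_regular : morphism_on pm_dom pm_fun
}.

(* A representative of a rational map; has_value, the indeterminacy locus,
   dominance and the pullback only depend on the rational map itself. *)
Record rational_map : Type := RationalMap {
  rm_val :> partial_morphism;
  rm_dense : dense (pm_dom rm_val)
}.

Implicit Types phi : partial_morphism.

Definition dominant phi : Prop := dense (pm_fun phi @` pm_dom phi).

(* The rational map represented by phi is defined at x, with value y: it is
   given near x by a morphism, possibly not the chosen representative. *)
Definition has_value phi (x : pts X) (y : pts Y) : Prop :=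
  exists (W : set (pts X)) (g : pts X -> pts Y),
    [/\ zopen W, W x, morphism_on W g,
        forall z, W z -> pm_dom phi z -> g z = pm_fun phi z & g x = y].

Definition indeterminacy_locus phi : set (pts X) :=
  [set x | ~ exists y, has_value phi x y].

Lemma zopen_preim U f (W : set (pts Y)) :
  morphism_on U f -> zopen W -> zopen (U `&` f @^-1` W).
Proof.
move=> mf /zopenP oW; apply: zopen_local => x [Ux Wfx].
have [j dj] := chart_cover (f x); have [p [px Hp]] := oW j _ Wfx dj.
have [W' [oW' W'x W'U dW' rW']] := mf x Ux j dj.
have row y : \row_c chart j (f y) 0 c = chart j (f y).
  by apply/rowP => c; rewrite mxE.
exists (W' `&` [set y | peval p (\row_c chart j (f y) 0 c) != 0]); split.
- by apply: zopen_neq0 => //; exact: regular_peval.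
- by split=> //=; rewrite row.
- move=> y [W'y /=]; rewrite row => py; split; first exact: W'U.
  by apply: Hp => //; exact: dW'.
Qed.

Lemma regular_comp U f (W : set (pts Y)) (h : pts Y -> K) :
  morphism_on U f -> zopen W -> regular_on W h ->
  regular_on (U `&` f @^-1` W) (h \o f).
Proof.
move=> mf oW rh; apply: regular_local => x [Ux Wfx].
have [j dj] := chart_cover (f x); have [p [q [qx H]]] := rh j _ Wfx dj.
have [W' [oW' W'x W'U dW' rW']] := mf x Ux j dj.
have row y : \row_c chart j (f y) 0 c = chart j (f y).
  by apply/rowP => c; rewrite mxE.
pose N := W' `&` [set y | peval q (\row_c chart j (f y) 0 c) != 0].
have oN : zopen N by apply: zopen_neq0 => //; exact: regular_peval.
have oP := zopen_preim mf oW.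
exists (N `&` (U `&` f @^-1` W)); split; first exact: zopenI.
  by split=> //; split=> //=; rewrite row.
apply: (@regular_ext _ _ (fun y => peval p (\row_c chart j (f y) 0 c)
                          * (peval q (\row_c chart j (f y) 0 c))^-1)).
  move=> y [[W'y /=]]; rewrite row => qy [Uy Wy].
  by rewrite [RHS]H //; exact: dW'.
have sW' : N `&` (U `&` f @^-1` W) `<=` W' by move=> y [[]].
apply: regularM; first by apply: regular_peval => c; exact: regular_sub (rW' c).
apply: regularV; [exact: zopenI | | by move=> y [[]]].
by apply: regular_peval => c; exact: regular_sub (rW' c).
Qed.

End PartialMorphisms.

(* phi (Z) `<=` Z is tested on the whole domain of definition of phi. *)
Definition invariant (X : variety) (phi : partial_morphism X X)
    (Z : set (pts X)) : Prop :=
  [/\ zclosed Z, ~ Z `<=` indeterminacy_locus phi &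
      forall x y, Z x -> has_value phi x y -> Z y].

(* -------------------------------------------------------------------------- *)

Section Pullback.
Variables (X Y : irr_variety) (phi : partial_morphism X Y).
Hypothesis dphi : dominant phi.

Lemma pullback_neq0 (W : set (pts Y)) : zopen W -> W !=set0 ->
  (pm_dom phi `&` pm_fun phi @^-1` W) !=set0.
Proof. by move=> oW nW; have [_ [[x dx <-] Wx]] := dphi oW nW; exists x. Qed.

Definition rep_pullback (f : ratrep Y) : ratrep X :=
  Ratrep (zopen_preim (@pm_regular _ _ phi) (rdom_open f))
    (pullback_neq0 (rdom_open f) (rdom_neq0 f))
    (regular_comp (@pm_regular _ _ phi) (rdom_open f) (@rval_regular _ f)).

Definition pullback (f : ratfun Y) : ratfun X := rpi (rep_pullback (repr f)).

Lemma rpi_pullback f : pullback (rpi f) = rpi (rep_pullback f).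
Proof.
have [W [oW nW sW eW]] := rateq_repr f.
apply/rpiP; exists (pm_dom phi `&` pm_fun phi @^-1` W); split.
- exact: zopen_preim (@pm_regular _ _ phi) oW.
- exact: pullback_neq0.
- by move=> x [dx /sW[? ?]].
- by move=> x [dx Wx]; exact: eW.
Qed.

Lemma pullback_is_zmod : zmod_morphism pullback.
Proof.
elim/ratfunW=> f; elim/ratfunW=> g.
rewrite -[LHS]/(pullback (ratfun_add _ (ratfun_opp _))).
rewrite rpi_opp rpi_add !rpi_pullback.
rewrite -[RHS]/(ratfun_add _ (ratfun_opp _)) rpi_opp rpi_add.
exact: rpi_val.
Qed.

Lemma pullback_is_monoid : monoid_morphism pullback.
Proof.
split; first by rewrite -[1]/(rpi _) rpi_pullback; exact: rpi_val.
elim/ratfunW=> f; elim/ratfunW=> g.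
rewrite -[LHS]/(pullback (ratfun_mul _ _)) rpi_mul !rpi_pullback.
by rewrite -[RHS]/(ratfun_mul _ _) rpi_mul; exact: rpi_val.
Qed.

HB.instance Definition _ := GRing.isZmodMorphism.Build
  (ratfun Y) (ratfun X) pullback pullback_is_zmod.
HB.instance Definition _ := GRing.isMonoidMorphism.Build
  (ratfun Y) (ratfun X) pullback pullback_is_monoid.

Lemma pullback_const a : pullback (ratfun_const Y a) = ratfun_const X a.
Proof. by rewrite rpi_pullback; exact: rpi_val. Qed.

End Pullback.

(* -------------------------------------------------------------------------- *)

Section IdProduct.
Variables (V X : variety) (phi : partial_morphism X X).
Local Notation VX := (prod_variety V X).

Lemma zopen_fst (W : set (pts V)) : zopen W -> @zopen VX [set z | W z.1].
Proof.
move=> /zopenP oW; apply/zopenP => -[i j] [v x] /= Wv [/= dv dx].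
have [p [pv Hp]] := oW i v Wv dv.
exists (plift (lshift _) p); rewrite plift_lshift; split=> // -[w y] [/= dw dy].
by rewrite plift_lshift; exact: Hp.
Qed.

Lemma zopen_snd (W : set (pts X)) : zopen W -> @zopen VX [set z | W z.2].
Proof.
move=> /zopenP oW; apply/zopenP => -[i j] [v x] /= Wx [/= dv dx].
have [p [px Hp]] := oW j x Wx dx.
exists (plift (@rshift _ _) p); rewrite plift_rshift; split=> // -[w y] [/= dw dy].
by rewrite plift_rshift; exact: Hp.
Qed.

Lemma regular_fst W f :
  regular_on W f -> @regular_on VX [set z | W z.1] (fun z => f z.1).
Proof.
move=> rf [i j] [v x] /= Wv [/= dv dx]; have [p [q [qv H]]] := rf i v Wv dv.
exists (plift (lshift _) p), (plift (lshift _) q).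
rewrite plift_lshift; split=> // -[w y] /= Ww [/= dw dy].
by rewrite !plift_lshift; exact: H.
Qed.

Lemma regular_snd W f :
  regular_on W f -> @regular_on VX [set z | W z.2] (fun z => f z.2).
Proof.
move=> rf [i j] [v x] /= Wx [/= dv dx]; have [p [q [qx H]]] := rf j x Wx dx.
exists (plift (@rshift _ _) p), (plift (@rshift _ _) q).
rewrite plift_rshift; split=> // -[w y] /= Ww [/= dw dy].
by rewrite !plift_rshift; exact: H.
Qed.

Lemma regular_chart (Y : variety) (j : cidx Y) c :
  regular_on (dom j) (fun y => chart j y 0 c).
Proof.
move=> i x dj di; have [p [q [qx H]]] := transition_regular c di dj.
by exists p, q; split=> // y dj' di'; exact: H.
Qed.

Lemma id_prod_morphism :
  @morphism_on VX VX [set z | pm_dom phi z.2] (fun z => (z.1, pm_fun phi z.2)).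
Proof.
move=> [v x] /= dx [i j] [/= dv dfx].
have [W [oW Wx WU dW rW]] := pm_regular dx dfx.
exists ([set z | dom i z.1] `&` [set z | W z.2]); split=> //.
- by apply: zopenI; [apply/zopen_fst/zopen_dom | exact: zopen_snd].
- by move=> [w y] [/= _ /WU].
- by move=> [w y] [/= dw /dW].
move=> c; case: (splitP c) => d dc.
  have -> : c = lshift _ d by exact/val_inj.
  apply: (@regular_ext _ _ (fun z : pts VX => chart i z.1 0 d)).
    by move=> z _; rewrite /= /prod_chart row_mxEl.
  by apply: regular_sub (regular_fst (@regular_chart V i d)) => z [].
have -> : c = rshift _ d by exact/val_inj.
apply: (@regular_ext _ _ (fun z : pts VX => chart j (pm_fun phi z.2) 0 d)).
  by move=> z _; rewrite /= /prod_chart row_mxEr.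
by apply: regular_sub (regular_snd (rW d)) => z [].
Qed.

(* The product V x X need not be irreducible when k is not algebraically closed.
   The domain of id_prod is dense as soon as that of phi is, because the
   projection to X is open, but density is not part of partial_morphism. *)
Definition id_prod : partial_morphism VX VX :=
  PartialMorphism (zopen_snd (pm_open phi)) id_prod_morphism.

End IdProduct.

(* -------------------------------------------------------------------------- *)

Record rational_dynamical_system : Type := RationalDynamicalSystem {
  rds_variety :> irr_variety;
  rds_quasi_projective : quasi_projective rds_variety;
  rds_map : rational_map rds_variety rds_variety;
  rds_dominant : dominant rds_map
}.

Definition rds_pullback (D : rational_dynamical_system) : ratfun D -> ratfun D :=
  pullback (@rds_dominant D).

Definition Fix (D : rational_dynamical_system) : set (ratfun D) :=
  [set f | rds_pullback f = f].

Definition adim (D : rational_dynamical_system) : nat :=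
  trdeg (@ratfun_const D) (@Fix D).

Record invariant_family (D : rational_dynamical_system) (n : nat) : Type :=
  InvariantFamily {
    fam_base : irr_variety;
    fam_total : irr_subvariety (prod_variety fam_base D);
    fam_dominant :
      dense [set v : pts fam_base | exists x, isv_set fam_total (v, x)];
    fam_dim :
      variety_dim (irr_variety_of fam_total) = (variety_dim fam_base + n)%N;
    fam_invariant : invariant (id_prod fam_base (rds_map D)) (isv_set fam_total)
  }.

Definition covering (D : rational_dynamical_system) (n : nat)
    (F : invariant_family D n) : Prop :=
  dense [set x : pts D | exists v, isv_set (fam_total F) (v, x)].

End Varieties.

(* Main.v *)
(* Let C be the fixed field of phi^* in k(X).  A k(V)-linear relation between
   rational functions on X, read in k(Z), is preserved by phi^*: the relation
   holds at the points of Z where it makes sense, and id x phi maps Z to Z.  By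
   Artin's argument for linear independence over fixed fields, elements of k(X)
   which are algebraically independent over C are then so over k(V), and there
   are at most trdeg(k(Z) / k(V)) = n of them.  Hence
   dim X = trdeg C + trdeg(k(X) / C) <= adim + n.
   The map induced by id x phi on Z need not be dominant, so it gives no
   endomorphism of k(Z); this is why one argues on relations. *)

Require Import Defs.
From HB Require Import structures.
From mathcomp Require Import all_boot all_order all_algebra perm.
From mathcomp Require Import boolp classical_sets.
From mathcomp Require Import mpoly.

Set Implicit Arguments.
Unset Strict Implicit.
Unset Printing Implicit Defensive.

Import GRing.Theory.

Local Open Scope classical_set_scope.
Local Open Scope ring_scope.

(** * Algebraic closure in a field *)

Section GeneratedSubfield.
Variable F : fieldType.
Implicit Types (A B : set F) (x y : F).

(** The subfield generated by [A]. As an intersection its minimality is immediate, and as a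
    predicate it can carry the division ring structure. *)
Definition fgen A : {pred F} := fun x =>
  `[< forall S : {pred F}, GRing.divring_closed S ->
      (forall y, A y -> y \in S) -> x \in S >].

Lemma fgenP A x : reflect (forall S : {pred F}, GRing.divring_closed S ->
  (forall y, A y -> y \in S) -> x \in S) (x \in fgen A).
Proof. exact: asboolP. Qed.

Lemma fgen_divring_closed A : GRing.divring_closed (fgen A).
Proof.
split=> [|x y /fgenP gx /fgenP gy|x y /fgenP gx /fgenP gy];
  apply/fgenP => S dS AS; case: (dS) => S1 SB SV; first exact: S1.
  by apply: SB; [exact: gx | exact: gy].
by apply: SV; [exact: gx | exact: gy].
Qed.

HB.instance Definition _ A :=
  GRing.isDivringClosed.Build F (fgen A) (fgen_divring_closed A).

Lemma sub_fgen A x : A x -> x \in fgen A.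
Proof. by move=> Ax; apply/fgenP => S _; apply. Qed.

Lemma fgen_min A (S : {pred F}) : GRing.divring_closed S ->
  (forall y, A y -> y \in S) -> {subset fgen A <= S}.
Proof. by move=> dS AS x /fgenP; apply. Qed.

(** The same subfield as a field of its own with an embedding into [F], because algebraicity and
    algebraic independence are both relative to a morphism of fields. *)
Record subfield A := Subfield { sfval : F; _ : sfval \in fgen A }.

HB.instance Definition _ A := [isSub for @sfval A].
HB.instance Definition _ A := [Choice of subfield A by <:].
HB.instance Definition _ A := [SubChoice_isSubComUnitRing of subfield A by <:].
HB.instance Definition _ A :=
  [SubComUnitRing_isSubIntegralDomain of subfield A by <:].
HB.instance Definition _ A :=
  [SubIntegralDomain_isSubField of subfield A by <:].

Definition sfemb A : {rmorphism subfield A -> F} := val.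

Lemma sfemb_fgen A (a : subfield A) : @sfemb A a \in fgen A.
Proof. exact: valP. Qed.

Lemma range_sfemb A : range (@sfemb A) = [set x | x \in fgen A].
Proof.
apply/seteqP; split=> [_ [a _ <-]|x /= gx]; first exact: sfemb_fgen.
by exists (Subfield gx).
Qed.

(** The relative algebraic closure in [F]; it is the closure operator of the matroid whose bases are
    the transcendence bases. *)
Definition acl A : set F := algebraicOver (@sfemb A).

Lemma aclP A x : acl A x <->
  exists p : {poly F}, [/\ p != 0, p \is a polyOver (fgen A) & root p x].
Proof.
split=> [[p p0 px]|[p [p0 pA px]]].
  exists (map_poly (@sfemb A) p); split=> //; first by rewrite map_poly_eq0.
  by apply/polyOverP => i; rewrite coef_map sfemb_fgen.
(* The default 0 of [insubd] is never taken: every coefficient of [p] lies in [fgen A]. *)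
pose q := \poly_(i < size p) insubd (0 : subfield A) p`_i.
have qp : map_poly (@sfemb A) q = p.
  apply/polyP => i; rewrite coef_map coef_poly; case: ltnP => [_|le].
    by rewrite [LHS]insubdK //; exact: (polyOverP pA).
  by rewrite raddf0 nth_default.
exists q; last by rewrite qp.
by rewrite -(map_poly_eq0 (@sfemb A)) qp.
Qed.

Lemma fgen_acl A x : x \in fgen A -> acl A x.
Proof.
by move=> gx; rewrite -[x]/(@sfemb A (Subfield gx)); exact: algebraic_id.
Qed.

Lemma sub_acl A : A `<=` acl A.
Proof. by move=> x Ax; exact/fgen_acl/sub_fgen. Qed.

Lemma aclW A B : (forall x, A x -> x \in fgen B) -> acl A `<=` acl B.
Proof.
move=> AB x /aclP[p [p0 pA px]]; apply/aclP; exists p; split=> //.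
apply/polyOverP => i; apply: (fgen_min (fgen_divring_closed B)) AB _ _.
exact: (polyOverP pA).
Qed.

Lemma acl_mono A B : A `<=` B -> acl A `<=` acl B.
Proof. by move=> AB; apply: aclW => x /AB; exact: sub_fgen. Qed.

(** Transitivity of algebraicity: over a field algebraic means integral, and a root of a nonzero
    polynomial with integral coefficients is integral. The coefficients are algebraic over [A]
    because the algebraic elements form a field containing [B]. *)
Lemma acl_idem A B : B `<=` acl A -> acl B `<=` acl A.
Proof.
move=> BA x /aclP[p [p0 pB px]]; apply/integral_algebraic.
apply: integral_root p0 px _ => y /(nthP 0)[i _ <-]; apply/integral_algebraic.
have clE : GRing.divring_closed (fun x => `[< acl A x >]).
  split=> [|u v /asboolP uA /asboolP vA|u v /asboolP uA /asboolP vA].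
  - exact/asboolP/algebraic1.
  - exact/asboolP/algebraic_sub.
  - exact/asboolP/algebraic_div.
apply/asboolP; apply: (fgen_min clE) (polyOverP pB i) => z Bz.
exact/asboolP/BA.
Qed.

Lemma acl_fgen A B : acl ([set x | x \in fgen A] `|` B) = acl (A `|` B).
Proof.
apply/seteqP; split; last by apply: acl_mono => x [/sub_fgen|]; [left|right].
apply: aclW => x [/= gx|Bx]; last by apply: sub_fgen; right.
apply: (fgen_min (fgen_divring_closed _)) gx => y Ay.
by apply: sub_fgen; left.
Qed.

End GeneratedSubfield.

Lemma mpoly_rmorph_ext n (R : comNzRingType) (S : nzRingType)
    (f g : {rmorphism {mpoly R[n]} -> S}) :
  (forall c, f c%:MP = g c%:MP) -> (forall i, f 'X_i = g 'X_i) -> f =1 g.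
Proof.
move=> fgC fgX; elim/mpolyind => [|c m p _ _ IH]; first by rewrite !rmorph0.
rewrite !rmorphD IH -mul_mpolyC !rmorphM fgC; congr (_ * _ + _).
rewrite mpolyXE_id !rmorph_prod; apply: eq_bigr => i _.
by rewrite !rmorphXn fgX.
Qed.

(** * Splitting off the last variable of a polynomial *)

Section SplitLastVariable.
Variables (n : nat) (R : comNzRingType).

(** The isomorphism from R[X_0, ..., X_n] to R[X_0, ..., X_(n-1)][X_n], with inverse [mpoly_last].
    It reduces algebraic independence to questions on polynomials in one variable. *)
Definition poly_last : {mpoly R[n.+1]} -> {poly {mpoly R[n]}} :=
  mmap (polyC \o @mpolyC n R)
    (fun i => if unlift ord_max i is Some j then ('X_j)%:P else 'X).

Definition mwiden_last : {mpoly R[n]} -> {mpoly R[n.+1]} :=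
  mmap (@mpolyC n.+1 R) (fun j => 'X_(lift ord_max j)).

Definition mpoly_last (P : {poly {mpoly R[n]}}) : {mpoly R[n.+1]} :=
  (map_poly mwiden_last P).['X_ord_max].

HB.instance Definition _ := GRing.RMorphism.on poly_last.
HB.instance Definition _ := GRing.RMorphism.on mwiden_last.

Lemma mpoly_last_morph :
  zmod_morphism mpoly_last * monoid_morphism mpoly_last.
Proof.
rewrite /mpoly_last; split.
  by move=> p q; rewrite rmorphB hornerD hornerN.
by split=> [|p q]; rewrite ?rmorph1 ?hornerE // rmorphM hornerM.
Qed.
HB.instance Definition _ := GRing.isZmodMorphism.Build _ _ mpoly_last
  mpoly_last_morph.1.
HB.instance Definition _ := GRing.isMonoidMorphism.Build _ _ mpoly_last
  mpoly_last_morph.2.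

Lemma poly_lastK : cancel poly_last mpoly_last.
Proof.
apply: (@mpoly_rmorph_ext n.+1 R _ (mpoly_last \o poly_last) idfun) => [c|i] /=.
  rewrite /poly_last mmapC /mpoly_last /= map_polyC hornerC /=.
  by rewrite /mwiden_last mmapC.
rewrite /poly_last mmapX mmap1U /mpoly_last.
case: unliftP => [j ->|->].
  by rewrite map_polyC hornerC /= /mwiden_last mmapX mmap1U.
by rewrite map_polyX hornerX.
Qed.

Lemma mpoly_lastK : cancel mpoly_last poly_last.
Proof.
have wK : poly_last \o mwiden_last =1 polyC.
  apply: mpoly_rmorph_ext => [c|i] /=.
    by rewrite /mwiden_last mmapC /poly_last mmapC.
  by rewrite /mwiden_last mmapX mmap1U /poly_last mmapX mmap1U liftK.
elim/poly_ind => [|P c IH]; first by rewrite !rmorph0.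
rewrite !rmorphD !rmorphM /= IH; congr (_ * _ + _).
  rewrite /mpoly_last map_polyX hornerX /poly_last mmapX mmap1U.
  by rewrite unlift_none.
by rewrite /mpoly_last map_polyC hornerC; exact: wK.
Qed.

Lemma mmap_mpoly_last (S : comNzRingType) (c : {rmorphism R -> S}) t P :
  mmap c t (mpoly_last P)
    = (map_poly (mmap c (t \o lift ord_max)) P).[t ord_max].
Proof.
have w p : mmap c t (mwiden_last p) = mmap c (t \o lift ord_max) p.
  apply: (@mpoly_rmorph_ext n R S (mmap c t \o mwiden_last)) => [a|i] /=.
    by rewrite /mwiden_last !mmapC.
  by rewrite /mwiden_last !mmapX !mmap1U mmapX mmap1U.
have eX : t ord_max = mmap c t 'X_ord_max by rewrite mmapX mmap1U.
rewrite /mpoly_last eX -horner_map -map_poly_comp; congr horner.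
by apply: eq_map_poly => p; exact: w.
Qed.

End SplitLastVariable.

(** * Algebraically independent families *)

Section AlgebraicIndependence.
Variables (k F : fieldType) (c : {rmorphism k -> F}).
Implicit Types (E : set F) (s : seq F).

Lemma mmap_fgen n (t : 'I_n -> F) p :
  mmap c t p \in fgen (range c `|` range t).
Proof.
rewrite rpred_sum // => m _; rewrite rpredM //.
  by apply: sub_fgen; left; exists p@_m.
by rewrite rpred_prod // => i _; rewrite rpredX // sub_fgen //; right; exists i.
Qed.

(** The quotients of values of polynomials form a field that contains the generators. *)
Lemma fgen_mmap n (t : 'I_n -> F) x : x \in fgen (range c `|` range t) ->
  exists p q, mmap c t q != 0 /\ x = mmap c t p / mmap c t q.
Proof.
pose S y := `[< exists p q, mmap c t q != 0 /\ y = mmap c t p / mmap c t q >].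
suff dS : GRing.divring_closed S.
  move=> gx; apply/asboolP; apply: (fgen_min dS) gx => y [[a _ <-]|[i _ <-]].
    apply/asboolP; exists a%:MP, 1.
    by rewrite rmorph1 mmapC divr1 oner_neq0.
  apply/asboolP; exists 'X_i, 1.
  by rewrite rmorph1 mmapX mmap1U divr1 oner_neq0.
split.
- by apply/asboolP; exists 1, 1; rewrite rmorph1 divr1 oner_neq0.
- move=> y z /asboolP[p [q [q0 ->]]] /asboolP[p' [q' [q'0 ->]]].
  apply/asboolP; exists (p * q' - p' * q), (q * q').
  rewrite rmorphB !rmorphM /= mulf_neq0 //; split=> //.
  by rewrite -[- (_ / _)]mulNr addf_div // mulNr.
- move=> y z /asboolP[p [q [q0 ->]]] /asboolP[p' [q' [q'0 ->]]].
  (* If the divisor is 0, so is the quotient by convention, and 0 / 1 represents it. *)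
  have [p'0|p'0] := eqVneq (mmap c t p') 0.
    apply/asboolP; exists 0, 1.
    by rewrite rmorph0 rmorph1 oner_neq0 p'0 mul0r invr0 !mulr0 mul0r.
  apply/asboolP; exists (p * q'), (q * p').
  by rewrite !rmorphM /= mulf_neq0 //; split=> //; rewrite invf_div mulf_div.
Qed.

(** Induction in Horner form: a common denominator for the higher coefficients is multiplied by that
    of the constant one. *)
Lemma clear_denominators n (t : 'I_n -> F) p :
    p \is a polyOver (fgen (range c `|` range t)) ->
  exists q (P : {poly {mpoly k[n]}}),
    mmap c t q != 0 /\ mmap c t q *: p = map_poly (mmap c t) P.
Proof.
elim/poly_ind: p => [_|p a IH pa].
  by exists 1, 0; rewrite rmorph1 oner_neq0 rmorph0 scaler0.
have [|q [P [q0 qP]]] := IH.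
  apply/polyOverP => i.
  by have := polyOverP pa i.+1; rewrite coefD coefMX coefC /= addr0.
have : a \in fgen (range c `|` range t).
  by have := polyOverP pa 0; rewrite coefD coefMX coefC /= add0r.
move=> /fgen_mmap[u [v [v0 ->]]].
exists (q * v), (P * 'X * v%:P + (q * u)%:P); split.
  by rewrite rmorphM mulf_neq0.
rewrite rmorphD /=.
rewrite (rmorphM (map_poly (mmap c t)) _ v%:P) /=.
rewrite (rmorphM (map_poly (mmap c t)) _ 'X) /=.
rewrite map_polyX !map_polyC -qP /= !(rmorphM (mmap c t)) /= scalerDr.
congr (_ + _); last by rewrite -mul_polyC -!polyCM mulrACA mulfV // mulr1.
by rewrite -!mul_polyC polyCM -!mulrA; congr (_ * _); rewrite mulrC -mulrA.
Qed.

(** An equation for the last element over the field generated by the others becomes, after clearing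
    denominators, a polynomial relation in all variables. Conversely a nonzero relation, seen as a
    polynomial in the last variable, stays nonzero when its coefficients are evaluated at the other,
    independent, elements. *)
Lemma alg_independent_last n (t : 'I_n.+1 -> F) :
  alg_independent c t <->
  alg_independent c (t \o lift ord_max) /\
  ~ acl (range c `|` range (t \o lift ord_max)) (t ord_max).
Proof.
set t' := t \o _; split=> [indt|[indt' nalg] p p0].
  split=> [p p0|/aclP[p [p0 pA px]]].
    have := indt (mpoly_last p%:P).
    rewrite mmap_mpoly_last map_polyC hornerC => /(_ p0) P0.
    apply: polyC_inj; apply: (can_inj (@mpoly_lastK _ _)).
    by rewrite P0 rmorph0.
  have [q [P [q0 qP]]] := clear_denominators pA.
  have P0 : P = 0.
    apply: (can_inj (@mpoly_lastK _ _)); rewrite rmorph0; apply: indt.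
    by rewrite mmap_mpoly_last -qP hornerZ (rootP px) mulr0.
  move: qP; rewrite P0 rmorph0 => /eqP.
  by rewrite scaler_eq0 (negPf q0) (negPf p0).
have [//|pn0] := eqVneq p 0; exfalso; apply: nalg; apply/aclP.
exists (map_poly (mmap c t') (poly_last p)); split.
- apply/eqP => /polyP P0; case/eqP: pn0.
  apply: (can_inj (@poly_lastK _ _)); rewrite rmorph0; apply/polyP => i.
  by rewrite coef0; apply: indt'; have := P0 i; rewrite coef_map coef0.
- by apply/polyOverP => i; rewrite coef_map; exact: mmap_fgen.
- by apply/rootP; rewrite -mmap_mpoly_last poly_lastK.
Qed.

(** Permuting the variables is an automorphism of the polynomial ring. *)
Lemma alg_independent_perm n (t : 'I_n -> F) (s : {perm 'I_n}) :
  alg_independent c t -> alg_independent c (t \o s).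
Proof.
move=> indt p p0.
pose u (r : {perm 'I_n}) : {rmorphism _ -> _} :=
  mmap (@mpolyC n k) (fun i => 'X_(r i)).
have usK : cancel (u s) (u s^-1%g).
  apply: (mpoly_rmorph_ext (f := u s^-1%g \o u s) (g := idfun)) => [a|i] /=.
    by rewrite !mmapC.
  by rewrite !mmapX !mmap1U mmapX mmap1U permK.
apply: (can_inj usK); rewrite rmorph0; apply: indt; rewrite -{}p0.
apply: (mpoly_rmorph_ext (f := mmap c t \o u s)) => [a|i] /=.
  by rewrite !mmapC.
by rewrite !mmapX !mmap1U mmapX mmap1U.
Qed.

Lemma alg_independent0 (t : 'I_0 -> F) : alg_independent c t.
Proof.
move=> p; rewrite [p]nvar0_mpolyC mmapC => /eqP.
by rewrite fmorph_eq0 => /eqP ->.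
Qed.
(* Algebraic independence over the field generated by A. *)
Fixpoint ind (A : set F) s : Prop :=
  if s is x :: s' then ind A s' /\ ~ acl (A `|` [set` s']) x else True.

(** Repeated use of [alg_independent_last]. The list is reversed because [ind] keeps at its head the
    element that was added last. *)
Lemma alg_independentE n (t : 'I_n -> F) :
  alg_independent c t <-> ind (range c) (rev (codom t)).
Proof.
elim: n t => [|n IH] t.
  split=> _; last exact: alg_independent0.
  by rewrite /codom /image_mem (size0nil (size_enum_ord 0)).
have -> : codom t = rcons (codom (t \o lift ord_max)) (t ord_max).
  rewrite /codom /image_mem enum_ordSr map_rcons -map_comp; congr rcons.
  apply: eq_map => i /=; congr t; apply/val_inj.
  by rewrite /= /bump leqNgt ltn_ord.
rewrite rev_rcons /= alg_independent_last IH.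
suff -> : range (t \o lift ord_max)
  = [set` rev (codom (t \o lift ord_max))] by [].
apply/seteqP; split=> [_ [i _ <-]|x] /=; first by rewrite mem_rev codom_f.
by rewrite mem_rev => /codomP[i ->]; exists i.
Qed.

Lemma codom_nth_rev s : codom (fun i : 'I_(size s) => (rev s)`_i) = rev s.
Proof.
rewrite /codom /image_mem (map_comp (nth 0 (rev s)) val) val_enum_ord -size_rev.
exact: mkseq_nth.
Qed.

Lemma indE s :
  ind (range c) s <-> alg_independent c (fun i : 'I_(size s) => (rev s)`_i).
Proof. by rewrite alg_independentE codom_nth_rev revK. Qed.

End AlgebraicIndependence.

(** * The exchange property and the size of independent families *)

Section Steinitz.
Variable F : fieldType.
Implicit Types (A B : set F) (s u : seq F).

Lemma acl_range_sfemb A B :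
  acl (range (@sfemb F A) `|` B) = acl (A `|` B).
Proof. by rewrite range_sfemb acl_fgen. Qed.

(** Exchange is the symmetry of independence: if [y] were not algebraic over [A] and [x], the family
    x, y would be independent over [A], hence also y, x, which contradicts the dependence of [x] on
    [y]. *)
Lemma acl_exchange A x y :
  acl (A `|` [set y]) x -> ~ acl A x -> acl (A `|` [set x]) y.
Proof.
move=> Ayx nAx; apply: contrapT => nAxy.
have set1 (z : F) : [set` [:: z]] = [set z].
  apply/seteqP; split=> w /=; first by rewrite mem_seq1 => /eqP.
  by move=> ->; exact: mem_head.
have set_nil : [set` [::]] = set0 :> set F by apply/seteqP; split=> w.
have indyx : ind (range (@sfemb F A)) [:: y; x].
  by rewrite /= !acl_range_sfemb set1 set_nil setU0.
have := alg_independent_perm (s := tperm ord0 ord_max) ((indE _ _).1 indyx).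
rewrite alg_independentE /codom /image_mem 2!enum_ordSl.
rewrite (size0nil (size_enum_ord 0)) /=.
have -> : lift ord0 ord0 = ord_max :> 'I_2 by exact/val_inj.
rewrite tpermL tpermR /= /rev /= !acl_range_sfemb set1 set_nil setU0.
by move=> [_]; apply.
Qed.

Lemma ind_sub A B s : A `<=` B -> ind B s -> ind A s.
Proof.
move=> AB; elim: s => //= x s IH [/IH ? nx]; split=> //.
by move=> Ax; apply: nx; apply: acl_mono Ax => y [/AB|]; [left|right].
Qed.

Lemma ind_cat A s u :
  ind A u -> ind (A `|` [set` u]) s -> ind A (s ++ u).
Proof.
move=> indu; elim: s => //= x s IH [/IH ? nx]; split=> //.
move=> Ax; apply: nx; apply: acl_mono Ax => y /=.
by rewrite mem_cat => -[Ay|/orP[sy|uy]]; [left; left | right | left; right].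
Qed.

(** [x] takes the place of the first element of [u] without which it leaves the closure of [A] and
    the elements that follow. *)
Lemma acl_exchange_seq A x u : acl (A `|` [set` u]) x -> ~ acl A x ->
  exists u', size u = (size u').+1 /\
    [set` u] `<=` acl (A `|` [set x] `|` [set` u']).
Proof.
move=> + nx; elim: u => [Ax|y u IH].
  by exfalso; apply: nx; apply: acl_mono Ax => z [].
have [/IH[u' [su uu']] _|nux] := pselect (acl (A `|` [set` u]) x).
  exists (y :: u'); split=> [|z /=]; first by rewrite /= su.
  rewrite inE => /orP[/eqP -> |/uu'].
    by apply: sub_acl; right; rewrite /= mem_head.
  by apply: acl_mono => w [|u'w]; [left | right; rewrite /= inE u'w orbT].
move=> Ax; exists u; split=> // z /=.
rewrite inE => /orP[/eqP -> |uz]; last first.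
  by apply: sub_acl; right.
suff : acl (A `|` [set` u] `|` [set x]) y by rewrite setUAC.
apply: acl_exchange nux; apply: acl_mono Ax => w [Aw|/=]; first by left; left.
by rewrite inE => /orP[/eqP|]; [right | left; right].
Qed.

(** Proved in a stronger form fit for induction: the elements of [s] replace, one at a time, as many
    elements of [u], and what remains of [u] is [u']. *)
Lemma steinitz A s u : ind A s -> [set` s] `<=` acl (A `|` [set` u]) ->
  (size s <= size u)%N.
Proof.
suff H : ind A s -> [set` s] `<=` acl (A `|` [set` u]) -> exists u',
    (size s + size u')%N = size u /\
    [set` u] `<=` acl (A `|` [set` s] `|` [set` u']).
  by move=> i c; have [u' [<- _]] := H i c; exact: leq_addr.
elim: s => [|x s IH] /= => [_ _|[inds nx] xsA].
  by exists u; split=> // y uy; apply: sub_acl; right.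
have [|u' [su uu']] := IH inds.
  by move=> y sy; apply: xsA; rewrite /= inE (_ : y \in s) ?orbT.
have subA : A `|` [set` u] `<=` acl (A `|` [set` s] `|` [set` u']).
  by move=> y [Ay|/uu' //]; apply: sub_acl; left; left.
have /acl_exchange_seq[//|u'' [su' u'u'']] :
    acl (A `|` [set` s] `|` [set` u']) x.
  by apply: acl_idem subA _ _; apply: xsA; exact: mem_head.
exists u''; split; first by rewrite -su su' addSnnS.
move=> y /uu'; apply: acl_idem => {}y.
have sub : A `|` [set` s] `|` [set x] `|` [set` u'']
    `<=` A `|` [set` x :: s] `|` [set` u''].
  move=> z [[[Az|sz]|->]|u''z];
    [by left; left | left; right | left; right | by right].
    by rewrite /= inE (_ : z \in s) ?orbT.
  exact: mem_head.
move=> [As|/u'u''].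
  by apply: sub_acl; apply: sub; left; left.
exact: acl_mono.
Qed.

(** An element of [E] outside the closure could be added to [s]. *)
Lemma ind_max_acl A (E : set F) s : [set` s] `<=` E -> ind A s ->
  (forall s', [set` s'] `<=` E -> ind A s' -> (size s' <= size s)%N) ->
  E `<=` acl (A `|` [set` s]).
Proof.
move=> sE inds smax x Ex; apply: contrapT => nx.
have := smax (x :: s); rewrite /= ltnn => H; suff: false by [].
by apply: H; [move=> y /=; rewrite inE => /orP[/eqP ->|/sE] | split].
Qed.

Lemma ind_max_ex A (E : set F) N :
  (forall s, [set` s] `<=` E -> ind A s -> (size s <= N)%N) ->
  exists s, [/\ [set` s] `<=` E, ind A s &
    forall s', [set` s'] `<=` E -> ind A s' -> (size s' <= size s)%N].
Proof.
move=> bnd.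
pose P n := `[< exists s, [/\ [set` s] `<=` E, ind A s & size s = n] >].
have exP : exists n, P n by exists 0%N; apply/asboolP; exists [::].
have ubP n : P n -> (n <= N)%N by move=> /asboolP[s [sE /bnd + <-]]; apply.
case: (ex_maxnP exP ubP) => n /asboolP[s [sE inds <-]] smax.
exists s; split=> // s' sE' inds'; apply: smax.
by apply/asboolP; exists s'.
Qed.

End Steinitz.

(** * Linear disjointness from a fixed field *)

Section LinearDisjointness.
Variables (L F M : fieldType).
Variables (alpha : {rmorphism L -> M}) (beta : {rmorphism F -> M}).
Variable sigma : {rmorphism F -> F}.

Hypothesis sigma_rel : forall m (c : 'I_m -> L) (f : 'I_m -> F),
  \sum_i alpha (c i) * beta (f i) = 0 ->
  \sum_i alpha (c i) * beta (sigma (f i)) = 0.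

(* Artin's argument: once f ord0 = 1, the difference of the relation and its
   image under sigma is shorter. *)
Lemma fix_relation m (c : 'I_m -> L) (f : 'I_m -> F) :
    \sum_i alpha (c i) * beta (f i) = 0 -> (exists i, c i != 0) ->
  exists g : 'I_m -> F, [/\ forall i, sigma (g i) = g i, exists i, g i != 0 &
    \sum_i g i * f i = 0].
Proof.
elim: m c f => [|m IH] c f cf0 [i0 ci0]; first by case: i0 {ci0}.
have [f0|f0] := eqVneq (f ord0) 0.
  (* The single term 1 * [f ord0] is already a relation with fixed coefficients. *)
  exists (fun i => (i == ord0)%:R); split=> [i||]; first exact: rmorph_nat.
    by exists ord0; rewrite eqxx oner_neq0.
  rewrite big_ord_recl f0 mulr0 big1 ?addr0 // => i _.
  by rewrite eq_sym (negPf (neq_lift _ _)) mul0r.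
pose g i := f (lift ord0 i) / f ord0; pose d i := c (lift ord0 i).
have rel : alpha (c ord0) + \sum_i alpha (d i) * beta (g i) = 0.
  have -> : alpha (c ord0) + \sum_i alpha (d i) * beta (g i)
      = (\sum_i alpha (c i) * beta (f i)) * beta (f ord0)^-1.
    rewrite big_ord_recl mulrDl -mulrA -rmorphM mulfV // rmorph1 mulr1.
    congr (_ + _); rewrite mulr_suml; apply: eq_bigr => i _.
    by rewrite -mulrA -rmorphM.
  by rewrite cf0 mul0r.
have srel : alpha (c ord0) + \sum_i alpha (d i) * beta (sigma (g i)) = 0.
  have := @sigma_rel m.+1 c (fun i => f i / f ord0).
  by rewrite !big_ord_recl mulfV // !rmorph1 !mulr1; apply; exact: rel.
(* If all other coefficients vanish, the relation forces [c ord0] to vanish too, against the choice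
   of [i0]. *)
have [[i di]|d0] := pselect (exists i, d i != 0); last first.
  have dz i : d i = 0.
    by apply/eqP; apply: contrapT => /negP di; apply: d0; exists i.
  move: rel; rewrite big1 => [|i _]; last by rewrite dz rmorph0 mul0r.
  rewrite addr0 => /eqP; rewrite fmorph_eq0 => /eqP c00.
  case: (unliftP ord0 i0) ci0 => [j ->|->]; last by rewrite c00 eqxx.
  by rewrite -[c _]/(d j) dz eqxx.
have [|h [hs [j hj] hg]] :=
    IH d (fun i => sigma (g i) - g i) _ (ex_intro _ i di).
  under eq_bigr do rewrite rmorphB mulrBr.
  rewrite sumrB; apply/eqP; rewrite subr_eq0.
  by rewrite -(inj_eq (addrI (alpha (c ord0)))) rel srel.
(* The relation between the differences [sigma (g i) - g i] has fixed coefficients [h], and says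
   exactly that [e] is fixed. Then -e and [h] are the coefficients of a relation between 1 and the
   [g i], and multiplying by [f ord0] gives one between the [f i]. *)
pose e := \sum_i h i * g i.
have se : sigma e = e.
  apply/eqP; rewrite -subr_eq0 -hg rmorph_sum -sumrB; apply/eqP/eq_bigr => l _.
  by rewrite rmorphM hs mulrBr.
exists (fun i => if unlift ord0 i is Some l then h l else - e); split.
- by move=> l; case: unliftP => [l' _|_]; rewrite ?rmorphN ?se ?hs.
- by exists (lift ord0 j); rewrite liftK.
rewrite big_ord_recl unlift_none.
under eq_bigr do rewrite liftK -[f _](divfK f0) mulrA.
by rewrite -mulr_suml -mulrDl addNr mul0r.
Qed.

Definition fixed : set F := [set f | sigma f = f].

(** An algebraic relation over [L] is a linear one between monomials in [t]; [fix_relation] replaces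
    its coefficients by fixed ones, not all zero. *)
Lemma alg_independent_disjoint n (t : 'I_n -> F) :
  alg_independent (@sfemb F fixed) t -> alg_independent alpha (beta \o t).
Proof.
move=> indt p p0; apply/eqP; apply: contrapT => /negP pn0.
pose mm (i : 'I_(size (msupp p))) := tnth (in_tuple (msupp p)) i.
have rel : \sum_i alpha p@_(mm i) * beta (mmap1 t (mm i)) = 0.
  rewrite -[RHS]p0 /mmap [RHS]big_tnth; apply: eq_bigr => i _; congr (_ * _).
  by rewrite /mmap1 rmorph_prod; apply: eq_bigr => j _; rewrite rmorphXn.
have [|g [gs [i gi] grel]] := fix_relation rel.
  have lt0 : (0 < size (msupp p))%N by rewrite lt0n size_eq0 msupp_eq0.
  by exists (Ordinal lt0); rewrite -mcoeff_msupp mem_tnth.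
pose G i : subfield fixed := Subfield (sub_fgen (gs i)).
have Q0 : \sum_i G i *: 'X_[mm i] = 0 :> {mpoly (subfield fixed)[n]}.
  apply: indt; rewrite raddf_sum -[RHS]grel; apply: eq_bigr => j _.
  by rewrite [LHS](mmapZ t (@sfemb F fixed)) (mmapX t (@sfemb F fixed)).
case/eqP: gi; rewrite -[g i]/(@sfemb F fixed (G i)).
suff -> : G i = 0 by exact: rmorph0.
(* The monomials [mm] are distinct, so the coefficient of [Q0] at [mm i] is [G i]. *)
have := congr1 (mcoeff (mm i)) Q0; rewrite mcoeff0 raddf_sum /= (bigD1 i) //=.
rewrite mcoeffZ mcoeffX eqxx mulr1 big1 ?addr0 // => j ji.
rewrite mcoeffZ mcoeffX (_ : mm j == mm i = false) ?mulr0 //.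
apply/negbTE; apply: contraNneq ji => /eqP.
rewrite /mm !(tnth_nth 0%MM) nth_uniq ?msupp_uniq //= => /eqP e.
Qed.

End LinearDisjointness.

(** A morphism of fields is injective, so it creates no new relation. *)
Lemma alg_independent_rmorph (k F M : fieldType) (c : {rmorphism k -> F})
    (c' : {rmorphism k -> M}) (f : {rmorphism F -> M}) n (t : 'I_n -> F) :
  (forall a, f (c a) = c' a) -> alg_independent c t ->
  alg_independent c' (f \o t).
Proof.
move=> fc indt p p0; apply: indt; apply/eqP; rewrite -(fmorph_eq0 f) -p0.
apply/eqP; apply: (mpoly_rmorph_ext (f := f \o mmap c t)) => [a|i] /=.
  by rewrite !mmapC fc.
by rewrite !mmapX !mmap1U.
Qed.

(** * Transcendence degree through independent lists *)

Section TranscendenceDegree.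
Variables (k F : fieldType) (c : {rmorphism k -> F}).

Lemma has_alg_independentE (E : set F) d :
  has_alg_independent c E d <->
  exists s, [/\ [set` s] `<=` E, ind (range c) s & size s = d].
Proof.
split=> [[t [tE /alg_independentE indt]]|[s [sE /indE inds <-]]].
  exists (rev (codom t)); split=> //; last first.
    by rewrite size_rev size_codom card_ord.
  by move=> x /=; rewrite mem_rev => /codomP[i ->].
exists (fun i => (rev s)`_i); split=> // i.
by apply: sE; rewrite /= -mem_rev mem_nth // size_rev.
Qed.

Lemma has_alg_independent_trdeg E : has_alg_independent c E (trdeg c E).
Proof.
rewrite /trdeg; case: xgetP => [d _ [] //|_].
(* The default value 0 is attained as well, by the empty family. *)
by apply/has_alg_independentE; exists [::].
Qed.

(** The bound [N] ensures that a largest size exists, so that [trdeg] is not its default value. *)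
Lemma trdeg_max E N d : (forall e, has_alg_independent c E e -> (e <= N)%N) ->
  has_alg_independent c E d -> (d <= trdeg c E)%N.
Proof.
move=> bnd Ed; rewrite /trdeg; case: xgetP => [_ -> [_] |nex]; first exact.
have [|s [sE inds smax]] := @ind_max_ex _ (range c) E N.
  by move=> s sE inds; apply: bnd; apply/has_alg_independentE; exists s.
exfalso; apply: (nex (size s)); split.
  by apply/has_alg_independentE; exists s.
by move=> e /has_alg_independentE[s' [s'E inds' <-]]; exact: smax.
Qed.

Lemma acl_bound u E d : (forall x, acl (range c `|` [set` u]) x) ->
  has_alg_independent c E d -> (d <= size u)%N.
Proof.
move=> ux /has_alg_independentE[s [_ inds <-]].
by apply: steinitz inds _ => x _; exact: ux.
Qed.

End TranscendenceDegree.

(** * The inequality between transcendence degrees *)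

Section TranscendenceDegreeBound.
Variables (k L F M : fieldType).
Variables (cL : {rmorphism k -> L}) (cF : {rmorphism k -> F}).
Variables (cM : {rmorphism k -> M}).
Variables (alpha : {rmorphism L -> M}) (beta : {rmorphism F -> M}).
Variable sigma : {rmorphism F -> F}.

Hypothesis alphaC : forall a, alpha (cL a) = cM a.
Hypothesis sigma_rel : forall m (c : 'I_m -> L) (f : 'I_m -> F),
  \sum_i alpha (c i) * beta (f i) = 0 ->
  \sum_i alpha (c i) * beta (sigma (f i)) = 0.

(** To be used with [L] = k(V), [F] = k(X) and [M] = k(Z). It combines additivity of the
    transcendence degree along k, the fixed field and [F] with the independence over [L] of families
    independent over the fixed field. *)
Lemma trdeg_fixed N :
    (forall d, has_alg_independent cF setT d -> (d <= N)%N) ->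
    (forall d, has_alg_independent cM setT d -> (d <= N)%N) ->
  (trdeg cF setT + trdeg cL setT <= trdeg cF (fixed sigma) + trdeg cM setT)%N.
Proof.
move=> bF bM; set C := fixed sigma.
have aclC (B : set F) : acl (range (@sfemb F C) `|` B) = acl (C `|` B).
  exact: acl_range_sfemb.
have [v [_ indv sv]] :=
  (has_alg_independentE _ _ _).1 (has_alg_independent_trdeg cL setT).
have [t [_ indt st]] :=
  (has_alg_independentE _ _ _).1 (has_alg_independent_trdeg cF setT).
(* The image of [s] under [beta] is independent over [L]; together with the image of the
   transcendence basis [v] of [L], it is independent over k in [M]. *)
have size_bound s : ind (range (@sfemb F C)) s ->
    (size s + trdeg cL setT <= trdeg cM setT)%N.
  move=> /indE/(alg_independent_disjoint sigma_rel)/alg_independentE.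
  set bs := rev _ => inds.
  have sbs : size bs = size s by rewrite size_rev size_codom card_ord.
  have kL : range cM `|` [set` map alpha v] `<=` range alpha.
    by move=> x [[a _ <-]|/mapP[y _ ->]]; [exists (cL a) | exists y].
  have indav : ind (range cM) (map alpha v).
    move: indv => /indE/(alg_independent_rmorph alphaC)/alg_independentE.
    have -> : codom (alpha \o (fun i : 'I_(size v) => (rev v)`_i))
        = map alpha (codom (fun i : 'I_(size v) => (rev v)`_i)).
      exact: map_comp.
    by rewrite codom_nth_rev map_rev revK.
  rewrite -sbs -sv -(size_map alpha) -size_cat.
  apply: (trdeg_max bM); apply/has_alg_independentE.
  exists (bs ++ map alpha v); split=> //.
  by apply: ind_cat indav (ind_sub kL inds).
(* [cs] is a transcendence basis of the fixed field over k, and [fs] below one of [F] over the fixed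
   field. *)
have [cs [csC indcs csmax]] : exists s, [/\ [set` s] `<=` C, ind (range cF) s &
    forall s', [set` s'] `<=` C -> ind (range cF) s' -> (size s' <= size s)%N].
  apply: (@ind_max_ex _ _ _ N) => s _ inds; apply: bF.
  by apply/has_alg_independentE; exists s.
have [fs [_ indfs fsmax]] : exists s, [/\ [set` s] `<=` setT,
    ind (range (@sfemb F C)) s & forall s', [set` s'] `<=` setT ->
    ind (range (@sfemb F C)) s' -> (size s' <= size s)%N].
  apply: (@ind_max_ex _ _ _ (trdeg cM setT)) => s _ /size_bound.
  exact/leq_trans/leq_addr.
have Ccs := ind_max_acl csC indcs csmax.
have Ffs := ind_max_acl (@subsetT _ _) indfs fsmax.
have st' : (size t <= size (cs ++ fs))%N.
  apply: steinitz indt _ => x _; have := Ffs x I; rewrite aclC.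
  apply: acl_idem => y [/Ccs|fy].
    by apply: acl_mono => z [|cz]; [left | right; rewrite /= mem_cat cz].
  by apply: sub_acl; right; rewrite /= mem_cat (_ : y \in fs) ?orbT.
rewrite -st; apply: leq_trans (leq_add st' (leqnn _)) _.
rewrite size_cat -addnA leq_add ?size_bound //.
apply: (trdeg_max (N := N)) => [d Cd|]; last first.
  by apply/has_alg_independentE; exists cs.
apply: bF; apply/has_alg_independentE.
by have [s [_ ? ?]] := (has_alg_independentE _ _ _).1 Cd; exists s.
Qed.

End TranscendenceDegreeBound.

(** * Rational functions on the family *)

Section Representatives.
Variables (k : fieldType) (K : closedFieldType) (iota : {rmorphism k -> K}).
Variable X : irr_variety iota.
Implicit Types (h : ratfun X) (g : pts X -> K) (W : set (pts X)).

(** Equality on a nonempty open set with a chosen representative. [g] is an arbitrary total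
    function, so sums, products and composites can be handled pointwise without tracking domains. *)
Definition represents h g : Prop := exists W, [/\ zopen W, W !=set0,
  W `<=` rdom (repr h) & forall x, W x -> rval (repr h) x = g x].

Lemma represents_rpi (f : ratrep X) : represents (rpi f) (rval f).
Proof.
have [W [oW nW sW eW]] := rateq_repr f.
by exists W; split=> // x /sW[].
Qed.

Lemma represents_repr h : represents h (rval (repr h)).
Proof. by rewrite -{1}[h]rpi_repr; exact: represents_rpi. Qed.

Lemma represents_ext h g g' W : zopen W -> W !=set0 ->
  (forall x, W x -> g x = g' x) -> represents h g -> represents h g'.
Proof.
move=> oW nW gg' [W' [oW' nW' sW' eW']]; exists (W `&` W'); split.
- exact: zopenI.
- exact: irreducible_setI (irr_irr X) _ _ _ _.
- by move=> x [_ /sW'].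
- by move=> x [Wx W'x]; rewrite eW' // gg'.
Qed.

Lemma represents_generic h g g' : represents h g -> represents h g' ->
  exists W, [/\ zopen W, W !=set0 & forall x, W x -> g x = g' x].
Proof.
move=> [W [oW nW sW eW]] [W' [oW' nW' sW' eW']]; exists (W `&` W'); split.
- exact: zopenI.
- exact: irreducible_setI (irr_irr X) _ _ _ _.
- by move=> x [Wx W'x]; rewrite -eW // eW'.
Qed.

Lemma represents_inj h h' g : represents h g -> represents h' g -> h = h'.
Proof.
move=> [W [oW nW sW eW]] [W' [oW' nW' sW' eW']].
rewrite -(rpi_repr h) -(rpi_repr h'); apply/rpiP; exists (W `&` W'); split.
- exact: zopenI.
- exact: irreducible_setI (irr_irr X) _ _ _ _.
- by move=> x [/sW ? /sW' ?].
- by move=> x [Wx W'x]; rewrite eW // eW'.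
Qed.

Lemma represents_const a : represents (ratfun_const X a) (fun=> iota a).
Proof. exact: represents_rpi. Qed.

Lemma represents_add h h' g g' : represents h g -> represents h' g' ->
  represents (h + h') (fun x => g x + g' x).
Proof.
move=> [W [oW nW sW eW]] [W' [oW' nW' sW' eW']].
apply: (@represents_ext _ _ _ (W `&` W')); last exact: represents_rpi.
- exact: zopenI.
- exact: irreducible_setI (irr_irr X) _ _ _ _.
- by move=> x [Wx W'x] /=; rewrite eW // eW'.
Qed.

Lemma represents_mul h h' g g' : represents h g -> represents h' g' ->
  represents (h * h') (fun x => g x * g' x).
Proof.
move=> [W [oW nW sW eW]] [W' [oW' nW' sW' eW']].
apply: (@represents_ext _ _ _ (W `&` W')); last exact: represents_rpi.
- exact: zopenI.
- exact: irreducible_setI (irr_irr X) _ _ _ _.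
- by move=> x [Wx W'x] /=; rewrite eW // eW'.
Qed.

Lemma represents_eq h g g' : g =1 g' -> represents h g -> represents h g'.
Proof. by move=> /funext ->. Qed.

Lemma represents_sum m (h : 'I_m -> ratfun X) (g : 'I_m -> pts X -> K) :
  (forall i, represents (h i) (g i)) ->
  represents (\sum_i h i) (fun x => \sum_i g i x).
Proof.
elim: m h g => [|m IH] h g hg.
  rewrite big_ord0; apply: represents_eq (represents_const 0) => x.
  by rewrite big_ord0 rmorph0.
rewrite big_ord_recl.
apply: represents_eq
  (represents_add (hg ord0) (IH _ _ (fun i => hg (lift ord0 i)))).
by move=> x; rewrite big_ord_recl.
Qed.

Lemma represents_mmap n (y : 'I_n -> ratfun X) (v : pts X -> 'rV[K]_n) p :
  (forall c, represents (y c) (fun x => v x 0 c)) ->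
  represents (mmap (@ratfun_const _ _ _ X) y p) (fun x => peval iota p (v x)).
Proof.
move=> yv; elim/mpolyind: p => [|a m p _ _ IH].
  rewrite mmap0; apply: represents_eq (represents_const 0) => x.
  by rewrite -mpolyC0 pevalC.
rewrite mmapD; apply: represents_eq (represents_add _ IH).
  by move=> x; rewrite pevalD.
rewrite mmapZ mmapX.
apply: represents_eq (represents_mul (represents_const a) _).
  by move=> x; rewrite /peval mmapZ mmapX.
rewrite /mmap1; elim: (index_enum _) => [|i s IHs].
  rewrite big_nil; apply: represents_eq (represents_const 1) => x.
  by rewrite big_nil rmorph1.
rewrite big_cons; apply: represents_eq (represents_mul _ IHs).
  by move=> x; rewrite big_cons.
elim: (m i) => [|d IHd].
  by apply: represents_eq (represents_const 1) => x; rewrite rmorph1.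
rewrite exprS; apply: represents_eq (represents_mul (yv i) IHd) => x.
by rewrite exprS.
Qed.

(** The coordinates of one chart generate the function field, since near a point of the chart a
    rational function is a quotient of polynomials in them. This bounds all transcendence degrees
    below. *)
Lemma ratfun_finitely_generated : exists u : seq (ratfun X),
  forall h, acl (range (@ratfun_const _ _ _ X) `|` [set` u]) h.
Proof.
have [[x0 _] _] := irr_irr X; have [i dx0] := chart_cover x0.
have ndi : dom i !=set0 by exists x0.
pose y c := rpi (Ratrep (zopen_dom i) ndi (regular_chart c)).
have yE c : represents (y c) (fun x => chart i x 0 c) by exact: represents_rpi.
exists (codom y) => h.
have [z [Uz dz]] := irreducible_setI (irr_irr X)
  (rdom_open (repr h)) (zopen_dom i) (rdom_neq0 _) ndi.
have [p [q [qz hpq]]] := rval_regular Uz dz.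
pose W := (rdom (repr h) `&` dom i) `&` [set x | peval iota q (chart i x) != 0].
have row x : \row_c chart i x 0 c = chart i x by apply/rowP => c; rewrite mxE.
have oW : zopen W.
  apply: zopen_neq0; first by apply: zopenI (zopen_dom _); exact: rdom_open.
  apply: (@regular_ext _ _ _ _ _
    (fun x => peval iota q (\row_c chart i x 0 c))).
    by move=> x _; rewrite row.
  apply: regular_peval => c.
  by apply: regular_sub (@regular_chart _ _ _ _ i c) => x [].
have nW : W !=set0 by exists z.
pose ev := mmap (@ratfun_const _ _ _ X) y.
(* The denominator has no zero on the nonempty open set [W], hence is not the zero rational
   function. *)
have q0 : ev q != 0.
  apply/eqP => q0.
  have := represents_mmap q yE; rewrite -/(ev q) q0.
  move=> /(represents_generic (represents_const 0))[W' [oW' nW' e]].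
  have [x [[_ /= qx] W'x]] := irreducible_setI (irr_irr X) oW oW' nW nW'.
  by rewrite -e // rmorph0 eqxx in qx.
have -> : h = ev p / ev q.
  apply: (canRL (mulfK q0)).
  apply: (@represents_inj _ _ (fun x => peval iota p (chart i x))).
    apply: represents_ext oW nW _
      (represents_mul (represents_repr h) (represents_mmap q yE)).
    by move=> x [[Ux dx] /= qx]; rewrite hpq // divfK.
  exact: represents_mmap.
have -> : [set` codom y] = range y.
  apply/seteqP; split=> [x /= /codomP[c ->]|_ [c _ <-]]; first by exists c.
  exact: codom_f.
by apply: fgen_acl; rewrite rpred_div // mmap_fgen.
Qed.

Lemma zopen_forall m (U : 'I_m -> set (pts X)) :
  (forall i, zopen (U i)) -> (forall i, U i !=set0) ->
  zopen [set x | forall i, U i x] /\ [set x | forall i, U i x] !=set0.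
Proof.
elim: m U => [|m IH] U oU nU.
  rewrite (_ : [set x | _] = setT); last by rewrite -subTset => x _ [].
  by split; [exact: zopenT | exact: (irr_irr X).1].
have [o n] := IH _ (fun i => oU (lift ord0 i)) (fun i => nU (lift ord0 i)).
rewrite (_ : [set x | _] = U ord0 `&` [set x | forall i, U (lift ord0 i) x]).
  by split; [exact: zopenI | exact: irreducible_setI (irr_irr X) _ _ _ _].
apply/seteqP; split=> [x Ux|x [Ux Ulx] i] /=; first by split=> // i.
by case: (unliftP ord0 i) => [j ->|-> //]; exact: Ulx.
Qed.

(** The open set where [g] does not vanish would otherwise meet [W]. This carries a generic identity
    to every point of [U], including special ones. *)
Lemma regular_eq0 U W g : zopen U -> regular_on U g -> zopen W -> W !=set0 ->
  (forall x, W x -> g x = 0) -> forall x, U x -> g x = 0.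
Proof.
move=> oU rg oW nW gW x Ux; apply/eqP; apply: contrapT => /negP gx.
have [|y [[_ /= gy] /gW gy0]] :=
    irreducible_setI (irr_irr X) (zopen_neq0 oU rg) oW _ nW.
  by exists x.
by rewrite gy0 eqxx in gy.
Qed.

End Representatives.

Lemma represents_pullback (k : fieldType) (K : closedFieldType)
    (iota : {rmorphism k -> K}) (X Y : irr_variety iota)
    (phi : partial_morphism X Y) (dphi : dominant phi) (h : ratfun Y) g :
  represents h g -> represents (pullback dphi h) (g \o pm_fun phi).
Proof.
move=> [W [oW nW sW eW]].
apply: (@represents_ext _ _ _ _ _ _ _ (pm_dom phi `&` pm_fun phi @^-1` W));
  last exact: represents_rpi.
- exact: zopen_preim (@pm_regular _ _ _ _ _ phi) oW.
- exact: pullback_neq0.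
- by move=> x [dx Wx]; exact: eW.
Qed.

(** * The projections of a closed subset of a product *)

Section ProjectionsOfCorrespondence.
Variables (k : fieldType) (K : closedFieldType) (iota : {rmorphism k -> K}).

Section ClosedSubvariety.
Variables (X : variety iota) (Z : set (pts X)) (Zcl : zclosed Z).
Local Notation Z' := (closed_subvariety Zcl).

Lemma regular_sum (U : set (pts X)) m (f : 'I_m -> pts X -> K) :
  (forall i, regular_on U (f i)) -> regular_on U (fun x => \sum_i f i x).
Proof.
elim: m f => [|m IH] f rf.
  apply: (@regular_ext _ _ _ _ _ (fun=> iota 0)); last exact: regular_cst.
  by move=> x _; rewrite big_ord0 rmorph0.
apply: (@regular_ext _ _ _ _ _
  (fun x => f ord0 x + \sum_i f (lift ord0 i) x)).
  by move=> x _; rewrite big_ord_recl.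
by apply: regularD => //; exact: IH.
Qed.

Lemma zopen_sub (W : set (pts X)) : zopen W ->
  @zopen _ _ _ Z' [set z | W (sval z)].
Proof.
move=> /zopenP oW; apply/zopenP => i z Wz dz.
have [p [pz Hp]] := oW i _ Wz dz.
by exists p; split=> // y dy py; exact: Hp.
Qed.

Lemma regular_restr (W : set (pts X)) f : regular_on W f ->
  @regular_on _ _ _ Z' [set z | W (sval z)] (f \o sval).
Proof.
move=> rf i z Wz dz; have [p [q [qz H]]] := rf i _ Wz dz.
by exists p, q; split=> // y Wy dy qy; exact: H.
Qed.

End ClosedSubvariety.

Variables (V X : variety iota) (Z : set (pts (prod_variety V X))).
Variable Zcl : zclosed Z.
Local Notation Z' := (closed_subvariety Zcl).

Lemma zopen_proj1 (W : set (pts V)) : zopen W ->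
  @zopen _ _ _ Z' [set z | W (sval z).1].
Proof. by move=> oW; exact: (zopen_sub (zopen_fst oW)). Qed.

Lemma zopen_proj2 (W : set (pts X)) : zopen W ->
  @zopen _ _ _ Z' [set z | W (sval z).2].
Proof. by move=> oW; exact: (zopen_sub (zopen_snd oW)). Qed.

Lemma regular_proj1 (W : set (pts V)) f : regular_on W f ->
  @regular_on _ _ _ Z' [set z | W (sval z).1] (fun z => f (sval z).1).
Proof. by move=> rf; exact: (regular_restr (regular_fst rf)). Qed.

Lemma regular_proj2 (W : set (pts X)) f : regular_on W f ->
  @regular_on _ _ _ Z' [set z | W (sval z).2] (fun z => f (sval z).2).
Proof. by move=> rf; exact: (regular_restr (regular_snd rf)). Qed.

Lemma proj1_morphism : @morphism_on _ _ _ Z' V setT (fun z => (sval z).1).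
Proof.
move=> z _ j dj; exists [set y | dom j (sval y).1]; split=> // [|c].
  exact/zopen_proj1/zopen_dom.
exact: regular_proj1 (@regular_chart _ _ _ V j c).
Qed.

Lemma proj2_morphism : @morphism_on _ _ _ Z' X setT (fun z => (sval z).2).
Proof.
move=> z _ j dj; exists [set y | dom j (sval y).2]; split=> // [|c].
  exact/zopen_proj2/zopen_dom.
exact: regular_proj2 (@regular_chart _ _ _ X j c).
Qed.

Definition proj1_map : partial_morphism Z' V :=
  PartialMorphism (@zopenT _ _ _ Z') proj1_morphism.

Definition proj2_map : partial_morphism Z' X :=
  PartialMorphism (@zopenT _ _ _ Z') proj2_morphism.

Lemma proj1_dominant : dense [set v | exists x, Z (v, x)] -> dominant proj1_map.
Proof.
move=> dV W oW nW; have [v [[x Zvx] Wv]] := dV W oW nW.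
by exists v; split=> //; exists (exist _ (v, x) Zvx).
Qed.

Lemma proj2_dominant : dense [set x | exists v, Z (v, x)] -> dominant proj2_map.
Proof.
move=> dX W oW nW; have [x [[v Zvx] Wx]] := dX W oW nW.
by exists x; split=> //; exists (exist _ (v, x) Zvx).
Qed.

(** The chosen representative of [id_prod V phi] itself witnesses the value at (v, x). *)
Lemma invariant_fiberwise (phi : partial_morphism X X) v x :
  Defs.invariant (id_prod V phi) Z -> Z (v, x) -> pm_dom phi x ->
  Z (v, pm_fun phi x).
Proof.
move=> [_ _ inv] Zvx dx; apply: inv Zvx _.
exists (pm_dom (id_prod V phi)), (pm_fun (id_prod V phi)); split=> //.
- exact: pm_open.
- exact: pm_regular.
Qed.

End ProjectionsOfCorrespondence.

(** * Relations on the total space of a covering family *)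

Section CoveringFamily.
Variables (k : fieldType) (K : closedFieldType) (iota : {rmorphism k -> K}).
Variables (D : rational_dynamical_system iota) (n : nat).
Variables (F : invariant_family D n) (covF : covering F).

Local Notation V := (fam_base F).
Local Notation Z := (irr_variety_of (fam_total F)).
Local Notation Zset := (isv_set (fam_total F)).
Local Notation phi := (rm_val (rds_map D)).

Let dV : @dominant _ _ _ Z V (proj1_map (isv_closed (fam_total F))) :=
  proj1_dominant (isv_closed (fam_total F)) (@fam_dominant _ _ _ _ _ F).
Let dX : @dominant _ _ _ Z D (proj2_map (isv_closed (fam_total F))) :=
  proj2_dominant (isv_closed (fam_total F)) covF.

(** The relation says that [g] vanishes generically on Z, hence wherever its terms are defined
    there. By invariance (v, phi x) is again a point of Z, and [g] can be evaluated at it. *)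
Lemma family_relation m (c : 'I_m -> ratfun V) (f : 'I_m -> ratfun D) :
  \sum_i pullback dV (c i) * pullback dX (f i) = 0 ->
  \sum_i pullback dV (c i) * pullback dX (rds_pullback (f i)) = 0.
Proof.
move=> rel.
pose g (v : pts V) (x : pts D) :=
  \sum_i rval (repr (c i)) v * rval (repr (f i)) x.
(* [A] and [B] are where the terms are defined at (v, x); [A] and [C], where they are defined at (v,
   phi x). *)
pose A i := [set z : pts Z | rdom (repr (c i)) (sval z).1].
pose B i := [set z : pts Z | rdom (repr (f i)) (sval z).2].
pose C i := [set z : pts Z | (pm_dom phi `&` pm_fun phi @^-1` rdom (repr (f i)))
  (sval z).2].
have oA i : zopen (A i) by exact/zopen_proj1/rdom_open.
have oB i : zopen (B i) by exact/zopen_proj2/rdom_open.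
have oP : zopen [set z : pts Z | pm_dom phi (sval z).2].
  exact/zopen_proj2/pm_open.
have oC i : zopen (C i).
  apply/zopen_proj2/zopen_preim; [exact: pm_regular | exact: rdom_open].
have nA i : A i !=set0.
  have [z [_ Az]] := pullback_neq0 dV (rdom_open (repr (c i))) (rdom_neq0 _).
  by exists z.
(* The covering hypothesis enters here: a nonempty open subset of X has a nonempty preimage in Z. *)
have nX (W : set (pts D)) : zopen W -> W !=set0 ->
    [set z : pts Z | W (sval z).2] !=set0.
  by move=> oW nW; have [z [_ Wz]] := pullback_neq0 dX oW nW; exists z.
have nB i : B i !=set0 by apply: nX; [exact: rdom_open | exact: rdom_neq0].
have nC i : C i !=set0.
  apply: nX; first by apply: zopen_preim; [exact: pm_regular | exact: rdom_open].
  exact: (pullback_neq0 (@rds_dominant _ _ _ D) (rdom_open (repr (f i)))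
    (rdom_neq0 _)).
have [oAs nAs] := zopen_forall oA nA.
have [oBs nBs] := zopen_forall oB nB.
have [oCs nCs] := zopen_forall oC nC.
have irrZ := irr_irr Z.
have rep_g : represents
    (\sum_i pullback dV (c i) * pullback dX (f i))
    (fun z => g (sval z).1 (sval z).2).
  apply: represents_sum => i; apply: represents_mul;
    exact: represents_pullback (represents_repr _).
have rep_gphi : represents
    (\sum_i pullback dV (c i) * pullback dX (rds_pullback (f i)))
    (fun z => g (sval z).1 (pm_fun phi (sval z).2)).
  apply: represents_sum => i; apply: represents_mul.
    exact: represents_pullback (represents_repr _).
  exact: represents_pullback (represents_pullback _ (represents_repr _)).
have [W [oW nW gW]] : exists W : set (pts Z),
    [/\ zopen W, W !=set0 & forall z, W z -> g (sval z).1 (sval z).2 = 0].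
  rewrite rel in rep_g.
  have [W [oW nW gW]] := represents_generic rep_g (represents_const Z 0).
  by exists W; split=> // z /gW ->; rewrite rmorph0.
pose U := [set z | forall i, A i z] `&` [set z | forall i, B i z].
(* All of [U] is needed, not only [W]: the points (v, phi x) may all avoid [W]. *)
have gU : forall z, U z -> g (sval z).1 (sval z).2 = 0.
  apply: regular_eq0 oW nW gW; first exact: zopenI.
  apply: regular_sum => i; apply: regularM.
    apply: regular_sub (regular_proj1 (@rval_regular _ _ _ _ (repr (c i)))).
    by move=> z [Az _]; exact: Az.
  apply: regular_sub (regular_proj2 (@rval_regular _ _ _ _ (repr (f i)))).
  by move=> z [_ Bz]; exact: Bz.
apply: represents_inj rep_gphi _.
have nAC := irreducible_setI irrZ oAs oCs nAs nCs.
have nP : [set z : pts Z | pm_dom phi (sval z).2] !=set0.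
  apply: nX; first exact: pm_open.
  have [x0 _] := (irr_irr D).1.
  have [_ [[x dx _] _]] := rds_dominant (@zopenT _ _ _ D) (irr_irr D).1.
  by exists x.
have nU := irreducible_setI irrZ (zopenI oAs oCs) oP nAC nP.
apply: represents_ext (zopenI (zopenI oAs oCs) oP) nU _ (represents_const Z 0).
move=> [[v x] Zvx] [[Az Cz] /= dx]; rewrite rmorph0; apply/esym.
have Zvx' := invariant_fiberwise (@fam_invariant _ _ _ _ _ F) Zvx dx.
apply: (gU (exist _ (v, pm_fun phi x) Zvx')); split=> i /=; first exact: Az.
by have [] := Cz i.
Qed.

(** By [trdeg_fixed], dim X + dim V is at most adim + dim Z; then dim Z = dim V + n and dim V
    cancels. *)
Lemma covering_trdeg : (variety_dim D - n <= adim D)%N.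
Proof.
have alphaC a : pullback dV (ratfun_const V a) = ratfun_const Z a.
  exact: pullback_const.
have [u gu] := ratfun_finitely_generated D.
have [u' gu'] := ratfun_finitely_generated Z.
have bound (G : irr_variety iota) (w : seq (ratfun G)) N :
    (forall h, acl (range (@ratfun_const _ _ _ G) `|` [set` w]) h) ->
    (size w <= N)%N ->
    forall d, has_alg_independent (@ratfun_const _ _ _ G) setT d -> (d <= N)%N.
  by move=> gw wN d /(acl_bound gw)/leq_trans; apply.
have := @trdeg_fixed _ _ _ _ (@ratfun_const _ _ _ V) (@ratfun_const _ _ _ D)
  (@ratfun_const _ _ _ Z) (pullback dV) (pullback dX)
  (pullback (@rds_dominant _ _ _ D))
  alphaC family_relation (maxn (size u) (size u'))
  (bound _ _ _ gu (leq_maxl _ _)) (bound _ _ _ gu' (leq_maxr _ _)).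
rewrite -/(variety_dim D) -/(variety_dim V) -/(variety_dim Z) -/(adim D).
rewrite fam_dim.
(* The truncated subtraction is harmless: the goal amounts to dim X being at most adim + n. *)
by rewrite addnCA addnC leq_add2l leq_subLR addnC.
Qed.

End CoveringFamily.

Theorem proposition2p6 (k : fieldType) (K : closedFieldType)
    (iota : {rmorphism k -> K}) (D : rational_dynamical_system iota) (n : nat)
    (F : invariant_family D n) :
  covering F -> (variety_dim D - n <= adim D)%N.
Proof. exact: covering_trdeg. Qed.
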